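(* Let $\pi$ be an order-$q$-subplane of $\mathrm{PG}(2,q^3)$ exterior to $\ell_\infty$, with exterior splash $\mathbb S$, conic cover $\mathbb C$, and tangent cover $\mathbb T$. 1. A 2-regulus of $\mathbb S$ corresponding to a $\pi$-pencil-subline of $\mathbb S$ meets each plane of $\mathbb C$ in a $\mathbb C$-special conic. 2. A 2-regulus of $\mathbb S$ corresponding to a $\pi$-dual-conic-subline of $\mathbb S$ meets each plane of $\mathbb T$ in a $\mathbb T$-special conic.
   Context: Let $q$ be a prime power, $\tau$ a primitive element of $\mathbb F_{q^3}$, and for $\alpha=a_0+a_1\tau+a_2\tau^2$ ($a_i\in\mathbb F_q$) write $[\alpha]=(a_0,a_1,a_2)$. Bruck-Bose correspondence: $\ell_\infty$ is the line $z=0$ of $\mathrm{PG}(2,q^3)$ and $\Sigma_\infty\cong\mathrm{PG}(5,q)$ is the hyperplane $z=0$ of $\mathrm{PG}(6,q)$, which has coordinates $(x_0,x_1,x_2,y_0,y_1,y_2,z)$. The affine point $(\alpha,\beta,1)$ corresponds to $([\alpha],[\beta],1)$. The point $L=(\alpha,\beta,0)$ of $\ell_\infty$ corresponds to the plane $[L]=\{([\alpha x],[\beta x],0): x\in\mathbb F_{q^3}\setminus\{0\}\}$. The planes $[L]$ form a regular 2-spread $\mathcal S$ of $\Sigma_\infty$. Order-$q$-subplanes of $\mathrm{PG}(2,q^3)$ are the images of $\mathrm{PG}(2,q)$ under $\mathrm{PGL}(3,q^3)$; order-$q$-sublines are lines of such subplanes, i.e. on $\ell_\infty$ the images of $\mathrm{PG}(1,q)$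 under $\mathrm{PGL}(2,q^3)$. If $\pi$ is exterior to $\ell_\infty$ (no points on $\ell_\infty$), its exterior splash $\mathbb S$ is the set of $q^2+q+1$ points of $\ell_\infty$ on extended lines of $\pi$, and also the corresponding set of planes of $\mathcal S$. A 2-regulus is a set of $q+1$ mutually disjoint planes such that a line meeting three of them meets all. An order-$q$-subline $b$ of $\ell_\infty$ corresponds to the 2-regulus $[b]=\{[L]:L\in b\}$ of $\mathcal S$ (known). Covers: by a result of Bruck there are two sets of $q^2+q+1$ planes of $\Sigma_\infty$, the covers of $\mathbb S$. Planes in the same set are disjoint, $\mathbb S$ and both covers have the same union of points, and planes from different sets meet in exactly one point. They are named relative to $\pi$ as follows. Let $\mathscr B$ be the order-$q$-subplane that is the image of $\mathrm{PG}(2,q)$ under the homography with matrix (acting on column vectors) $$K=\begin{pmatrix}-\tau&1&0\\-\tau^q&1&0\\\tau\tau^q&-\tau-\tau^q&1\end{pmatrix}.$$ It is exterior to $\ell_\infty$, with splash $\{(k,1,0):k\in\mathscr K\}$, $\mathscr K=\{k\in\mathbb F_{q^3}: k^{q^2+q+1}=1\}$. Its tangent cover consists of the planes $[T_k]=\{([kx],[x^q],0):x\in\mathbb F_{q^3}\setminus\{0\}\}$, $k\in\mathscr K$, and its conic cover of the planes $[C_k]=\{([kx],[x^{q^2}],0):x\in\mathbb F_{q^3}\setminus\{0\}\}$, $k\in\mathscr K$. For a general exterior $\pi$, there is a homography $\phi:(x,y,z)\mapsto(ax+by+ez,\,cx+dy+fz,\,z)$ of $\mathrm{PG}(2,q^3)$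 fixing $\ell_\infty$ with $\phi(\mathscr B)=\pi$. The tangent cover $\mathbb T$ and conic cover $\mathbb C$ of $\pi$ are the images of those of $\mathscr B$ under the induced map $([x],[y],0)\mapsto([ax+by],[cx+dy],0)$ of $\Sigma_\infty$ (for one, equivalently any, such $\phi$). Sublines of $\mathbb S$: if $A$ is a point of $\pi$, the $q+1$ (extended) lines of $\pi$ through $A$ meet $\ell_\infty$ in an order-$q$-subline of $\mathbb S$, called a $\pi$-pencil-subline of $\mathbb S$. Let $m,n$ be the two conjugates of $\ell_\infty$ with respect to $\pi$ (its images under the two nontrivial collineations in the order-3 collineation group of $\mathrm{PG}(2,q^3)$ fixing $\pi$ pointwise). A $(\pi,\ell_\infty)$-special dual conic is a (non-degenerate) dual conic of $\pi$ whose extension to $\mathrm{PG}(2,q^3)$ contains the three lines $\ell_\infty,m,n$. The $q+1$ lines of $\pi$ in such a dual conic meet $\ell_\infty$ in an order-$q$-subline of $\mathbb S$, called a $\pi$-dual-conic-subline of $\mathbb S$. Special conics: a transversal line of $\mathbb C$ is a line of the cubic extension $\mathrm{PG}(6,q^3)$, in the extension of $\Sigma_\infty$, that meets the extension of every plane of $\mathbb C$. There are exactly three, forming a conjugate triple $g_{\mathbb C},g_{\mathbb C}^q,g_{\mathbb C}^{q^2}$ under the Frobenius map on coordinates; similarly for $\mathbb T$. A $\mathbb C$-special conic is a non-degenerate conic contained in a plane of $\mathbb C$ whose extension to $\mathrm{PG}(6,q^3)$ meets the (three) transversals of $\mathbb C$. A $\mathbb T$-special conic is defined in the same way with $\mathbb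 T$ in place of $\mathbb C$. ''A 2-regulus meets a plane in a conic'' means that the set of points of the plane lying on planes of the 2-regulus is the point set of such a conic. *)

(* Defs.v *)
From HB Require Import structures.
From mathcomp Require Import all_boot all_order all_algebra all_field.
From mathcomp Require Import boolp classical_sets.

Set Implicit Arguments.
Unset Strict Implicit.
Unset Printing Implicit Defensive.

Import GRing.Theory.
Local Open Scope classical_set_scope.
Local Open Scope ring_scope.

(* PG(n - 1, K) is the lattice of subspaces of 'cV[K]_n : points, lines and
   planes are the subspaces of (vector) dimension 1, 2 and 3, and incidence is
   (U <= V)%VS.  Vectors are columns, and matrices act on the left. *)

Definition mx_of_rows (K : fieldType) m n (s : seq (seq K)) : 'M[K]_(m, n) :=
  \matrix_(i, j) (nth [::] s i)`_j.

Definition homography (K : fieldType) m n (M : 'M[K]_(m, n))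
    (U : {vspace 'cV[K]_n}) : {vspace 'cV[K]_m} :=
  (linfun (mulmx M : 'cV_n -> 'cV_m) @: U)%VS.

(* The hyperplane on which the last homogeneous coordinate vanishes. *)
Definition hyperplane_at_infinity (K : fieldType) n : {vspace 'cV[K]_n.+1} :=
  lker (linfun (row ord_max : 'cV[K]_n.+1 -> 'rV[K]_1)).

Definition line_of_coords (K : fieldType) (u : 'cV[K]_3) : {vspace 'cV[K]_3} :=
  lker (linfun (mulmx u^T : 'cV[K]_3 -> 'cV[K]_1)).

Section Conics.
Variable K : fieldType.

(* Every ternary quadratic form is v |-> v^T A v for some, not necessarily
   symmetric, A; this is also valid in characteristic 2. *)
Definition quadform (A : 'M[K]_3) (v : 'cV[K]_3) : K := (v^T *m A *m v) 0 0.

(* No singular vector lies in the radical of the polar form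
   (v, w) |-> Q (v + w) - Q v - Q w.  Over a finite (hence perfect) field this
   is non-singularity of the conic Q = 0 over the algebraic closure too. *)
Definition nondegenerate (A : 'M[K]_3) : Prop :=
  forall v : 'cV[K]_3, v != 0 -> quadform A v = 0 ->
  ~ (forall w : 'cV[K]_3, quadform A (v + w) = quadform A v + quadform A w).

Definition quadform_zeros (A : 'M[K]_3) : set 'cV[K]_3 :=
  [set v | v != 0 /\ quadform A v = 0].

(* The conic Q = 0 of the plane spanned by the columns of N, in the coordinates
   that these columns define on that plane. *)
Definition conic n (N : 'M[K]_(n, 3)) (A : 'M[K]_3) : set {vspace 'cV[K]_n} :=
  [set <[N *m v]>%VS | v in quadform_zeros A].

End Conics.

Section FieldExtension.
Variables (F : finFieldType) (L : fieldExtType F).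

Notation q := #|F|.
Notation emb := (map_mx (in_alg L)).

Definition extend n (U : {vspace 'cV[F]_n}) : {vspace 'cV[L]_n} :=
  <<[seq emb u | u <- vbasis U]>>%VS.

Definition line_at_infinity : {vspace 'cV[L]_3} := hyperplane_at_infinity L 2.

Definition base_subplane : set {vspace 'cV[L]_3} :=
  [set <[emb v]>%VS | v in [set v : 'cV[F]_3 | v != 0]].

Definition subplane (pi : set {vspace 'cV[L]_3}) : Prop :=
  exists2 M : 'M[L]_3, M \in unitmx & pi = homography M @` base_subplane.

Definition exterior (pi : set {vspace 'cV[L]_3}) : Prop :=
  forall P, pi P -> ~~ (P <= line_at_infinity)%VS.

(* The lines of pi, extended to lines of PG(2, q^3). *)
Definition lines_of (pi : set {vspace 'cV[L]_3}) : set {vspace 'cV[L]_3} :=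
  [set l | exists P Q, [/\ pi P, pi Q, P != Q & l = (P + Q)%VS]].

(* The exterior splash of pi is meet_infinity @` lines_of pi; the two kinds of
   sublines defined below are subsets of it. *)
Definition meet_infinity (l : {vspace 'cV[L]_3}) : {vspace 'cV[L]_3} :=
  (l :&: line_at_infinity)%VS.

Definition pencil_subline (pi b : set {vspace 'cV[L]_3}) : Prop :=
  exists2 A, pi A & b = meet_infinity @` [set l | lines_of pi l /\ (A <= l)%VS].

(* A collineation of PG(2, q^3) is induced by a bijective semilinear map. *)
Definition semilinear_image (M : 'M[L]_3) (s : {rmorphism L -> L})
    (U : {vspace 'cV[L]_3}) : {vspace 'cV[L]_3} :=
  <<[seq M *m map_mx s u | u <- vbasis U]>>%VS.

Definition collineation (f : {vspace 'cV[L]_3} -> {vspace 'cV[L]_3}) : Prop :=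
  exists (M : 'M[L]_3) (s : {rmorphism L -> L}),
    [/\ M \in unitmx, bijective s & f = semilinear_image M s].

Definition conjugates_of_infinity (pi : set {vspace 'cV[L]_3}) :
    set {vspace 'cV[L]_3} :=
  [set m | exists f, [/\ collineation f, forall P, pi P -> f P = P,
                         exists U, f U != U & m = f line_at_infinity]].

(* A dual conic of pi = M PG(2, q) is a quadratic form on the line coordinates
   of PG(2, q); its extension is given by the same form over F_{q^3}. *)
Definition special_dual_conic (pi D : set {vspace 'cV[L]_3}) : Prop :=
  exists (M : 'M[L]_3) (A : 'M[F]_3),
  let extended_dual_conic :=
    [set homography M (line_of_coords u) | u in quadform_zeros (emb A)] in
  [/\ M \in unitmx /\ pi = homography M @` base_subplane,
      nondegenerate A,
      D = [set homography M (line_of_coords (emb u)) | u in quadform_zeros A],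
      extended_dual_conic line_at_infinity
    & conjugates_of_infinity pi `<=` extended_dual_conic].

Definition dual_conic_subline (pi b : set {vspace 'cV[L]_3}) : Prop :=
  exists2 D, special_dual_conic pi D & b = meet_infinity @` D.

Section BruckBose.
Variable tau : L.

Definition coords (a : L) : 'cV[F]_3 :=
  \col_i coord [tuple 1; tau; tau ^+ 2] i a.

(* The vector ([x], [y], 0) of the hyperplane at infinity, for w = (x, y, 0). *)
Definition bruck_bose (w : 'cV[L]_3) : 'cV[F]_7 :=
  col_mx (col_mx (coords (w 0 0)) (coords (w 1 0))) (0 : 'cV_1).

Lemma coords_is_linear : linear coords.
Proof. by move=> a x y; apply/colP=> i; rewrite !mxE linearP. Qed.

Lemma limg_bruck_bose (g : L -> 'cV[L]_3) :
  (forall (a : F) x y, g (a *: x + y) = (in_alg L a) *: g x + g y) ->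
  forall v, reflect (exists x, v = bruck_bose (g x))
                    (v \in limg (linfun (fun x => bruck_bose (g x)))).
Proof.
move=> glin v.
have hlin : linear (fun x => bruck_bose (g x)).
  move=> a x y; rewrite /bruck_bose glin.
  have entry i : (in_alg L a *: g x + g y) i 0 = a *: g x i 0 + g y i 0.
    by rewrite 2!mxE mulr_algl.
  rewrite !entry !coords_is_linear.
  apply: (etrans _ (esym (congr1 (+%R^~ _) (@scale_col_mx F 6 1 1 a _ _)))).
  apply: (etrans _ (esym (@add_col_mx F 6 1 1 _ _ _ _))).
  congr (@col_mx F 6 1 1 _ _); last by rewrite scaler0 addr0.
  apply: (etrans _ (esym (congr1 (+%R^~ _) (@scale_col_mx F 3 3 1 a _ _)))).
  exact: (esym (@add_col_mx F 3 3 1 _ _ _ _)).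
pose h : {linear L -> 'cV[F]_7} := HB.pack (fun x => bruck_bose (g x))
  (GRing.isLinear.Build _ _ _ _ _ hlin).
rewrite -[X in linfun X]/(h : L -> _).
apply: (iffP memv_imgP) => [[x _ ->]|[x ->]]; first by exists x; rewrite lfunE.
by exists x; rewrite ?memvf // lfunE.
Qed.

(* The plane [X] of the spread, for a point X = <[(alpha, beta, 0)]> of the
   line at infinity. *)
Definition spread_plane (X : {vspace 'cV[L]_3}) : {vspace 'cV[F]_7} :=
  limg (linfun (fun x : L => bruck_bose (x *: vpick X))).

Lemma spread_planeP X v :
  reflect (exists x, v = bruck_bose (x *: vpick X)) (v \in spread_plane X).
Proof.
apply: limg_bruck_bose => a x y.
by rewrite scalerDl -[a *: x]mulr_algl scalerA.
Qed.

Definition regulus (b : set {vspace 'cV[L]_3}) : set {vspace 'cV[F]_7} :=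
  spread_plane @` b.

Definition reference_subplane : set {vspace 'cV[L]_3} :=
  homography (mx_of_rows 3 3
    [:: [:: - tau;           1;                  0];
        [:: - tau ^+ q;      1;                  0];
        [:: tau * tau ^+ q;  - tau - tau ^+ q;   1]]) @` base_subplane.

(* The image, under ([x], [y], 0) |-> ([a x + b y], [c x + d y], 0), of the
   plane {([k x], [x ^ r], 0)}, where Phi is the homography
   (x, y, z) |-> (a x + b y + e z, c x + d y + f z, z). *)
Definition cover_plane (Phi : 'M[L]_3) (r : nat) (k : L) : {vspace 'cV[F]_7} :=
  limg (linfun (fun x : L =>
    bruck_bose (Phi *m mx_of_rows 3 1 [:: [:: k * x]; [:: x ^+ r]; [:: 0]]))).

Lemma cover_planeP Phi n k v :
  reflect (exists x, v = bruck_bose (Phi *m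
             mx_of_rows 3 1 [:: [:: k * x]; [:: x ^+ (q ^ n)]; [:: 0]]))
          (v \in cover_plane Phi (q ^ n) k).
Proof.
apply: limg_bruck_bose => a x y.
rewrite scalemxAr -mulmxDr; congr (_ *m _); apply/colP=> i; rewrite !mxE.
have addX (u w : L) : (u + w) ^+ (q ^ n) = u ^+ (q ^ n) + w ^+ (q ^ n).
  have [p _ charF] := finPcharP F.
  have charL : p \in [pchar L] by rewrite pchar_lalg.
  apply: exprDn_pchar; rewrite (eq_pnat _ (pcharf_eq charL)) (card_pprimeChar charF).
  by rewrite !pnatX pnat_id ?(pcharf_prime charF).
have aX : a ^+ (q ^ n) = a.
  by elim: n {addX} => [|n IHn]; rewrite ?expn0 ?expr1 // expnS exprM expf_card.
case: i => [[|[|[|//]]] ?] /=; last by rewrite mulr0 addr0.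
  by rewrite mulrDr mulr_algl scalerAr.
by rewrite addX exprZn aX mulr_algl.
Qed.

(* C is the cover {cover_plane Phi r k : k in the norm-1 group} of pi, computed
   from a homography Phi that fixes the line at infinity and maps the reference
   subplane to pi. *)
Definition cover_of (r : nat) (pi : set {vspace 'cV[L]_3})
    (C : set {vspace 'cV[F]_7}) : Prop :=
  exists a b c d e f : L,
  let Phi := mx_of_rows 3 3 [:: [:: a; b; e]; [:: c; d; f]; [:: 0; 0; 1]] in
  [/\ Phi \in unitmx, pi = homography Phi @` reference_subplane
    & C = cover_plane Phi r @` [set k | k ^+ (q ^ 2 + q + 1) = 1]].

Definition tangent_cover := cover_of q.
Definition conic_cover := cover_of (q ^ 2).

End BruckBose.

(* PG(6, q^3) is the cubic extension of PG(6, q). *)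
Definition transversal (C : set {vspace 'cV[F]_7}) (g : {vspace 'cV[L]_7}) :
    Prop :=
  [/\ \dim g = 2%N, (g <= extend (hyperplane_at_infinity F 6))%VS
    & forall P, C P -> (g :&: extend P != 0)%VS].

(* c is a C-special conic lying in the plane P of C. *)
Definition special_conic (C : set {vspace 'cV[F]_7}) (P : {vspace 'cV[F]_7})
    (c : set {vspace 'cV[F]_7}) : Prop :=
  C P /\ exists (N : 'M[F]_(7, 3)) (A : 'M[F]_3),
  [/\ \rank N = 3%N /\ limg (linfun (mulmx N : 'cV_3 -> 'cV_7)) = P,
      nondegenerate A,
      c = conic N A
    & forall g, transversal C g ->
        exists2 X, conic (emb N) (emb A) X & (X <= g)%VS].

Definition points_covered (R : set {vspace 'cV[F]_7}) (P : {vspace 'cV[F]_7}) :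
    set {vspace 'cV[F]_7} :=
  [set X | [/\ \dim X = 1%N, (X <= P)%VS & exists2 Q, R Q & (X <= Q)%VS]].

End FieldExtension.

(* Main.v *)
Require Import Defs.
From HB Require Import structures.
From mathcomp Require Import all_boot all_order all_algebra all_fingroup
  all_field.
From mathcomp Require Import boolp classical_sets.
From mathcomp Require Import ring zify.

Set Implicit Arguments.
Unset Strict Implicit.
Unset Printing Implicit Defensive.

Import GRing.Theory.
Local Open Scope classical_set_scope.
Local Open Scope ring_scope.

(** Both parts are one computation in a cyclic cubic extension L / F, q = #|F|.
   Write N and Tr for the norm and the trace of L over F.

   In the frame where pi is the reference subplane, the line of pi with
   F-coordinates u meets the line at infinity in the point (t, t^q, 0), where
   t = u0 + u1 tau + u2 tau^2; this gives all the points of the splash, one for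
   each t up to a factor in F.  A point of pi imposes one F-linear condition on
   u, that is, Tr (g t) = 0 with g <> 0, so a pencil-subline consists of the
   points (t, t^q, 0) with t in a plane of L over F.  Extend u to L^3, with the
   coordinates u.w, u.w^q, u.w^(q^2), with w = (1, tau, tau^2): there, the line
   at infinity and its two conjugates are the three coordinate points, so the
   form of a special dual conic has no square terms and is Tr (a t^(q+1)) on
   F^3.  Dividing by N (t), its zeros are the t with Tr (a^q / t) = 0.  With
   s = t^q in the first case, with r = q^2, and s = 1 / t in the second, with
   r = q, both sublines become
     { (s^r, s, 0) : s <> 0, Tr (g s) = 0 },
   and r is exactly the exponent of the cover in the corresponding part: the
   conic cover consists of the planes {(k x, x^(q^2))}, the tangent cover of the
   planes {(k x, x^q)}, N (k) = 1.

   The plane of the point (s^r, s, 0) and the cover plane of k share the vector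
   (k x, x^r) exactly when (x s)^(r-1) = k.  By Hilbert 90 k = c^(r-1), so the
   condition is s = f c / x with f in F.  Hence the covered points of the cover
   plane are those with Tr (d / x) = 0, d = g c, which after multiplication by
   N (x) is the conic d x^q x^(q^2) + d^q x^(q^2) x + d^(q^2) x x^q = 0.  This
   form is non-degenerate, and in the coordinates (x, x^q, x^(q^2)) it vanishes
   at the three coordinate points because it has no square terms
   ([inverse_trace_form]).

   These coordinate points lie on the transversals.  In the coordinates
   x^(q^i), y^(q^i) of the extended hyperplane at infinity, the extension of the
   cover plane of k is spanned by one point on each of three fixed skew lines,
   and these three lines are the only transversals: a line meeting all the
   extended planes yields 2 x 2 determinants that are polynomials in k of degree
   at most q^2 + q with q^2 + q + 1 roots ([transversal_in_summand]).

   [regulus_meets_cover_plane] is the common computation;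
   [pencil_subline_trace] and [dual_conic_subline_trace] put the two kinds of
   sublines in the common form. *)

(** * Subspaces and quadratic forms in coordinates *)

Lemma big_ord3 (R : nmodType) (G : 'I_3 -> R) :
  \sum_i G i = G 0 + G 1 + G ord_max.
Proof.
rewrite !big_ord_recl big_ord0 addr0 addrA.
by congr (_ + _ + _); congr (G _); apply: val_inj.
Qed.

Lemma ord3P (P : 'I_3 -> Prop) : P 0 -> P 1 -> P ord_max -> forall i, P i.
Proof.
move=> P0 P1 P2 [[|[|[|//]]] lti].
- by rewrite (_ : Ordinal lti = 0) //; apply: val_inj.
- by rewrite (_ : Ordinal lti = 1) //; apply: val_inj.
by rewrite (_ : Ordinal lti = ord_max) //; apply: val_inj.
Qed.

Section Projective.
Variable K : fieldType.

Lemma homographyP m n (M : 'M[K]_(m, n)) (U : {vspace 'cV[K]_n}) w :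
  reflect (exists2 u, u \in U & w = M *m u) (w \in homography M U).
Proof.
by apply: (iffP memv_imgP) => -[u Uu ->]; exists u; rewrite // lfunE.
Qed.

Lemma mem_homography n (M : 'M[K]_n) (U : {vspace 'cV[K]_n}) v :
  M \in unitmx -> (M *m v \in homography M U) = (v \in U).
Proof.
move=> Mu; apply/homographyP/idP => [[u Uu /(congr1 (mulmx (invmx M)))]|Uv].
  by rewrite !mulKmx // => ->.
by exists v.
Qed.

Lemma homography_vline m n (M : 'M[K]_(m, n)) v :
  homography M <[v]> = <[M *m v]>%VS.
Proof. by rewrite /homography limg_line lfunE. Qed.

Lemma homographyM m n p (M : 'M[K]_(m, n)) (N : 'M[K]_(n, p)) U :
  homography (M *m N) U = homography M (homography N U).
Proof.
apply/vspaceP => w; apply/homographyP/homographyP => [[u Uu ->]|[v]].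
  by exists (N *m u); rewrite ?mulmxA //; apply/homographyP; exists u.
by case/homographyP => u Uu -> ->; exists u; rewrite // mulmxA.
Qed.

Lemma homography_scale m n (c : K) (M : 'M[K]_(m, n)) U :
  c != 0 -> homography (c *: M) U = homography M U.
Proof.
move=> c0; apply/vspaceP => w; apply/homographyP/homographyP => -[u Uu ->].
  by exists (c *: u); rewrite ?rpredZ // -scalemxAl -scalemxAr.
exists (c^-1 *: u); rewrite ?rpredZ //.
by rewrite -scalemxAl -scalemxAr scalerA divff // scale1r.
Qed.

Lemma dim_homography n (M : 'M[K]_n) (U : {vspace 'cV[K]_n}) :
  M \in unitmx -> \dim (homography M U) = \dim U.
Proof.
move=> Mu; apply: limg_dim_eq; apply/eqP; rewrite -subv0; apply/subvP => v.
rewrite memv_cap memv_ker lfunE memv0 => /andP[_ /eqP Mv0].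
by rewrite -(mulKmx Mu v) Mv0 mulmx0.
Qed.

Lemma mem_line_of_coords (u v : 'cV[K]_3) :
  (v \in line_of_coords u) = ((u^T *m v) 0 0 == 0).
Proof.
rewrite memv_ker lfunE /=; apply/eqP/eqP => [->|uv0]; first by rewrite mxE.
by apply/matrixP => i j; rewrite !ord1 uv0 mxE.
Qed.

Lemma mem_infinity n (v : 'cV[K]_n.+1) :
  (v \in hyperplane_at_infinity K n) = (v ord_max 0 == 0).
Proof.
rewrite memv_ker lfunE /=; apply/eqP/eqP => [/rowP/(_ 0)|v0]; first
  by rewrite !mxE.
by apply/matrixP => i j; rewrite !ord1 !mxE v0.
Qed.

Lemma dot_cV (u v : 'cV[K]_3) :
  (u^T *m v) 0 0 = u 0 0 * v 0 0 + u 1 0 * v 1 0 + u ord_max 0 * v ord_max 0.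
Proof. by rewrite mxE big_ord3 !mxE. Qed.

Lemma dot_row_neq0 (u : 'cV[K]_3) : u != 0 ->
  exists v : 'cV_3, (u^T *m v) 0 0 != 0.
Proof.
case/cV0Pn => i ui0; exists (delta_mx i 0).
by rewrite -colE !mxE.
Qed.

Lemma dim_cV n : \dim {: 'cV[K]_n} = n.
Proof. by rewrite dimvf /dim /= muln1. Qed.

Lemma dim_line_of_coords (u : 'cV[K]_3) : u != 0 ->
  \dim (line_of_coords u) = 2%N.
Proof.
move=> /dot_row_neq0[v uv0].
pose f := linfun (mulmx u^T : 'cV[K]_3 -> 'cV[K]_1).
have := limg_ker_dim f fullv; rewrite capfv dim_cV.
suff -> : \dim (limg f) = 1%N by rewrite addn1 => -[].
have le1: (\dim (limg f) <= 1)%N by rewrite -[leqRHS](dim_cV 1) dimvS ?subvf.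
apply/eqP; rewrite eqn_leq le1 lt0n dimv_eq0.
apply: contra uv0 => /eqP f0; have: f v \in limg f by rewrite memv_img ?memvf.
by rewrite f0 memv0 lfunE /= => /eqP ->; rewrite mxE.
Qed.

Lemma homography_line_of_coords (M : 'M[K]_3) u :
  M \in unitmx ->
  homography M (line_of_coords u) = line_of_coords ((invmx M)^T *m u).
Proof.
move=> Mu; apply/vspaceP => w.
rewrite -{1}(mulKVmx Mu w) mem_homography // !mem_line_of_coords.
by rewrite trmx_mul trmxK mulmxA.
Qed.

Lemma vline_scale n (c : K) (v : 'cV[K]_n) :
  c != 0 -> <[c *: v]>%VS = <[v]>%VS.
Proof.
move=> c0; apply/eqP; rewrite eqEsubv -!memvE.
rewrite memvZ ?memv_line //=; apply/vlineP; exists c^-1.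
by rewrite scalerA mulVf ?scale1r.
Qed.

Lemma vpick_vline n (v : 'cV[K]_n) :
  v != 0 -> exists2 c, c != 0 & vpick <[v]> = c *: v.
Proof.
move=> v0; have /vlineP[c ce] := memv_pick <[v]>%VS; exists c => //.
apply: contraNneq v0 => c0; move/eqP: ce; rewrite c0 scale0r vpick0.
by rewrite -dimv_eq0 dim_vline; case: (v == 0).
Qed.

Lemma dim1_vline n (X : {vspace 'cV[K]_n}) :
  \dim X = 1%N -> exists2 v, v != 0 & X = <[v]>%VS.
Proof.
move=> dX; have X0 : vpick X != 0 by rewrite vpick0 -dimv_eq0 dX.
exists (vpick X) => //; apply/eqP.
by rewrite eq_sym eqEdim -memvE memv_pick dX dim_vline X0.
Qed.

Lemma dim_sum_points n (P Q : {vspace 'cV[K]_n}) :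
  \dim P = 1%N -> \dim Q = 1%N -> P != Q -> \dim (P + Q) = 2%N.
Proof.
move=> dP dQ nPQ; have := dimv_sum_cap P Q; rewrite dP dQ.
suff -> : \dim (P :&: Q) = 0%N by rewrite addn0.
have le1 : (\dim (P :&: Q) <= 1)%N by rewrite -[leqRHS]dP dimvS ?capvSl.
apply/eqP; rewrite -leqn0 leqNgt; apply: contra nPQ => gt0.
have /eqP e1 : (P :&: Q)%VS == P by rewrite eqEdim capvSl dP gt0.
have /eqP e2 : (P :&: Q)%VS == Q by rewrite eqEdim capvSr dQ gt0.
by rewrite -e1 e2.
Qed.

Lemma common_annihilator (p r : 'cV[K]_3) :
  exists2 u : 'cV_3, u != 0 & (u^T *m p) 0 0 = 0 /\ (u^T *m r) 0 0 = 0.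
Proof.
pose B := row_mx p r; have kB : kermx B != 0.
  rewrite -mxrank_eq0 mxrank_ker -lt0n subn_gt0.
  by apply: leq_ltn_trans (rank_leq_col B) _.
exists (nz_row (kermx B))^T; first by rewrite trmx_eq0 nz_row_eq0.
rewrite trmxK; have /sub_kermxP := nz_row_sub (kermx B).
rewrite mul_mx_row -[RHS]row_mx0 => /eq_row_mx[-> ->].
by rewrite mxE.
Qed.

Lemma dim2_basis n (g : {vspace 'cV[K]_n}) :
  \dim g = 2%N ->
  exists w1 w2 : 'cV[K]_n,
    [/\ w1 \in g, w2 \in g,
        forall w, w \in g -> exists x y, w = x *: w1 + y *: w2
      & forall x y, x *: w1 + y *: w2 = 0 -> x = 0 /\ y = 0].
Proof.
move=> dg; have := vbasisP g; have := vbasis_mem.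
case: (vbasis g) => -[|w1 [|w2 [|? ?]]] /=; rewrite dg => // sz vm.
case/andP=> /eqP span_g free_g; exists w1, w2; split.
- by rewrite -span_g memv_span ?mem_head.
- by rewrite -span_g memv_span // !inE eqxx orbT.
- move=> w; rewrite -span_g span_cons span_seq1 => /memv_addP[_ /vlineP[x ->]].
  by case=> _ /vlineP[y ->] ->; exists x, y.
move=> x y xy0; have /freeP fr := free_g.
have := fr (fun i => [tuple x; y]`_i).
rewrite !big_ord_recl big_ord0 /= addr0 => /(_ xy0) xy.
by split; [have := xy 0 | have := xy 1].
Qed.

Lemma det2_eq0 (x y u1 u2 v1 v2 : K) :
  x * u1 + y * u2 = 0 -> x * v1 + y * v2 = 0 -> (x != 0) || (y != 0) ->
  u1 * v2 - u2 * v1 = 0.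
Proof.
move=> eu ev xy0; apply/eqP.
have ex : x * (u1 * v2 - u2 * v1) = 0.
  have -> : x * (u1 * v2 - u2 * v1) =
            (x * u1 + y * u2) * v2 - (x * v1 + y * v2) * u2 by ring.
  by rewrite eu ev !mul0r subr0.
have ey : y * (u1 * v2 - u2 * v1) = 0.
  have -> : y * (u1 * v2 - u2 * v1) =
            (x * v1 + y * v2) * u1 - (x * u1 + y * u2) * v1 by ring.
  by rewrite eu ev !mul0r subr0.
case/orP: xy0 => [x0|y0]; first by move/eqP: ex; rewrite mulf_eq0 (negPf x0).
by move/eqP: ey; rewrite mulf_eq0 (negPf y0).
Qed.

Lemma linear_mulmx m n (g : 'cV[K]_n -> 'cV[K]_m) :
  linear g -> exists N : 'M_(m, n), forall v, N *m v = g v.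
Proof.
move=> glin; pose h : {linear 'cV[K]_n -> 'cV[K]_m} := HB.pack g
  (GRing.isLinear.Build _ _ _ _ _ glin).
exists (\matrix_(i, j) g (delta_mx j 0) i 0) => v.
rewrite {2}[v]matrix_sum_delta -[g]/(h : _ -> _) linear_sum.
apply/colP => i; rewrite mxE summxE; apply: eq_bigr => j _.
by rewrite big_ord1 linearZ !mxE mulrC.
Qed.

Lemma quadform_congr (D W : 'M[K]_3) v :
  quadform (W^T *m D *m W) v = quadform D (W *m v).
Proof. by rewrite /quadform trmx_mul !mulmxA. Qed.

Lemma quadformE (D : 'M[K]_3) v :
  quadform D v =
    D 0 0 * v 0 0 ^+ 2 + D 1 1 * v 1 0 ^+ 2
      + D ord_max ord_max * v ord_max 0 ^+ 2
    + (D 0 1 + D 1 0) * (v 0 0 * v 1 0)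
    + (D 1 ord_max + D ord_max 1) * (v 1 0 * v ord_max 0)
    + (D ord_max 0 + D 0 ord_max) * (v ord_max 0 * v 0 0).
Proof.
rewrite /quadform mxE big_ord3 !mxE !big_ord3 !mxE; ring.
Qed.

Lemma quadformZ (D : 'M[K]_3) c v :
  quadform D (c *: v) = c ^+ 2 * quadform D v.
Proof. by rewrite !quadformE !mxE; ring. Qed.

End Projective.

(** * The Frobenius maps of a finite extension *)

Section Frobenius.
Variables (F : finFieldType) (L : fieldExtType F).
Notation q := #|F|.
Notation emb := (map_mx (in_alg L)).

Definition frob (i : nat) (x : L) : L := x ^+ (q ^ i).

Lemma frob_is_monoid_morphism i : monoid_morphism (frob i).
Proof. by split=> [|x y]; rewrite /frob ?expr1n ?exprMn. Qed.

Lemma frob_is_nmod_morphism i : nmod_morphism (frob i).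
Proof.
have [p _ charF] := finPcharP F.
have charL : p \in [pchar L] by rewrite pchar_lalg.
split=> [|x y].
  by rewrite /frob expr0n expn_eq0 (gtn_eqF (ltnW (finNzRing_gt1 F))).
apply: exprDn_pchar; rewrite (eq_pnat _ (pcharf_eq charL)) (card_pprimeChar
  charF).
by rewrite !pnatX pnat_id ?(pcharf_prime charF).
Qed.

HB.instance Definition _ i :=
  GRing.isNmodMorphism.Build L L (frob i) (frob_is_nmod_morphism i).
HB.instance Definition _ i :=
  GRing.isMonoidMorphism.Build L L (frob i) (frob_is_monoid_morphism i).

Lemma frob_alg i (a : F) : frob i a%:A = a%:A.
Proof.
rewrite /frob exprZn expr1n; congr _%:A.
by elim: i => [|i IHi]; rewrite ?expn0 ?expr1 // expnS exprM expf_card.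
Qed.

Lemma frob_frob i j x : frob i (frob j x) = frob (i + j) x.
Proof. by rewrite /frob -exprM -expnD addnC. Qed.

Lemma frob0 x : frob 0 x = x. Proof. by rewrite /frob expn0 expr1. Qed.

Lemma map_frob_emb i m n (A : 'M[F]_(m, n)) : map_mx (frob i) (emb A) = emb A.
Proof. by apply/matrixP => r s; rewrite !mxE frob_alg. Qed.

Lemma frob1_fixed x : frob 1 x = x -> exists a : F, x = a%:A.
Proof.
move=> fx; have : x \in (1%AS : {subfield L}).
  by rewrite Fermat's_little_theorem dimv1 -[X in X == _]/(frob 1 x) fx.
by case/vlineP => a; exists a.
Qed.

(** The matrices over F needed below are written down over L, in coordinates
    adapted to the Frobenius map; this descends them to F. *)
Lemma emb_frob_fixed m n (A : 'M[L]_(m, n)) :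
  map_mx (frob 1) A = A -> exists B : 'M[F]_(m, n), emb B = A.
Proof.
move=> fA.
have B r : exists b : F, A r.1 r.2 = b%:A.
  by apply: frob1_fixed; rewrite -[in RHS]fA !mxE.
have [g gP] := choice B; exists (\matrix_(i, j) g (i, j)).
by apply/matrixP => i j; rewrite !mxE [RHS](gP (i, j)).
Qed.

Hypothesis dimL : \dim {:L} = 3%N.

(** The Frobenius map has order 3 because L has q^3 elements. *)
Lemma frob3 x : frob 3 x = x.
Proof.
apply/eqP; rewrite -[_ == x]/(_ ^+ (q ^ 3) == x) -dimL.
by rewrite -Fermat's_little_theorem memvf.
Qed.

Lemma frobD3 i x : frob (i + 3) x = frob i x.
Proof. by rewrite -frob_frob frob3. Qed.

End Frobenius.

(** * Elements of norm one *)

Section NormOne.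
Variables (F : finFieldType) (L : fieldExtType F) (tau : L).
Notation q := #|F|.
Notation norm_one k := (k ^+ (q ^ 2 + q + 1) = 1).

Let q_gt1 : (1 < q)%N := finNzRing_gt1 F.

Lemma card_units : ((q ^ 3).-1 = q.-1 * (q ^ 2 + q + 1))%N.
Proof.
by case: #|F| q_gt1 => // n _; rewrite !expnS expn0 /=; nia.
Qed.

Hypothesis tau_prim : (q ^ 3).-1.-primitive_root tau.

(** The norm-one elements are the q^2 + q + 1 distinct powers of tau^(q-1), more
    than the degree of p. *)
Lemma poly_vanishing_on_norm_one (p : {poly L}) :
  (size p <= q ^ 2 + q + 1)%N -> (forall k : L, norm_one k -> p.[k] = 0) ->
    p = 0.
Proof.
move=> szp p0.
pose rs := [seq tau ^+ (q.-1 * m) | m <- iota 0 (q ^ 2 + q + 1)].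
have sz_rs : size rs = (q ^ 2 + q + 1)%N by rewrite size_map size_iota.
apply: (@roots_geq_poly_eq0 _ p rs); last by rewrite sz_rs.
  apply/allP => k /mapP[m _ ->]; apply/rootP/p0.
  rewrite -exprM mulnAC -card_units exprM (prim_expr_order tau_prim).
  by rewrite expr1n.
rewrite map_inj_in_uniq ?iota_uniq // => m m';
  rewrite !mem_iota => /andP[_ lt1] /andP[_ lt2].
have q1 : (0 < q.-1)%N by rewrite -ltnS prednK // ltnW.
move/eqP; rewrite (eq_prim_root_expr tau_prim) !modn_small ?card_units
  ?ltn_pmul2l //.
by rewrite eqn_pmul2l // => /eqP.
Qed.

(** If k = tau^i has norm one then q^3 - 1 divides i (q^2 + q + 1), so q - 1
    divides i. *)
Lemma norm_one_hilbert90 (k : L) : norm_one k ->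
  exists2 c, c != 0 & c ^+ q.-1 = k.
Proof.
move=> k1; have: k ^+ (q ^ 3).-1 = 1.
  by rewrite card_units mulnC exprM k1 expr1n.
case/(prim_rootP tau_prim) => -[i /= _] ki; move/eqP: k1.
rewrite ki -exprM -(prim_order_dvd tau_prim) card_units dvdn_pmul2r; last first.
  by rewrite addn1.
case/dvdnP => j ->; exists (tau ^+ j); last by rewrite -exprM.
by rewrite expf_neq0 // (prim_root_eq0 tau_prim) -lt0n (prim_order_gt0
  tau_prim).
Qed.

(** The left-hand side is a polynomial in k with the distinct exponents 0, q^i,
    q^j and q^i + q^j, the largest of which is at most q^2 + q. *)
Lemma bilinear_vanishing_on_norm_one i j (c00 c10 c01 c11 : L) :
    (i < j < 3)%N ->
    (forall k : L, norm_one k ->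
       c00 - frob i k * c10 - frob j k * c01 + frob i k * frob j k * c11 = 0) ->
  [/\ c00 = 0, c10 = 0, c01 = 0 & c11 = 0].
Proof.
case/andP => lt_ij lt_j3 H.
have qi0 : (0 < q ^ i)%N by rewrite expn_gt0 ltnW.
have qij : (q ^ i < q ^ j)%N by rewrite ltn_exp2l.
have qj2 : (q ^ j <= q ^ 2)%N by rewrite leq_exp2l.
have qi1 : (q ^ i <= q)%N.
  by rewrite -[leqRHS]expn1 leq_exp2l // -ltnS (leq_trans lt_ij).
pose p : {poly L} := c00%:P - c10 *: 'X^(q ^ i) - c01 *: 'X^(q ^ j)
                     + c11 *: 'X^(q ^ i + q ^ j).
have coefp n : p`_n = c00 *+ (n == 0%N) - c10 *+ (n == (q ^ i)%N) 
      - c01 *+ (n == (q ^ j)%N) + c11 *+ (n == (q ^ i + q ^ j)%N).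
  by rewrite !coefE !mulr_natr; case: (n == 0%N).
have p0 : p = 0.
  apply: poly_vanishing_on_norm_one => [|k k1].
    apply/leq_sizeP => n len; rewrite coefp.
    by rewrite !gtn_eqF ?subr0 ?addr0 //; lia.
  by rewrite -[RHS](H k k1) !hornerE exprD /frob; ring.
have c n : c00 *+ (n == 0%N) - c10 *+ (n == (q ^ i)%N) - c01 *+ (n == (q ^ j)%N)
                     + c11 *+ (n == (q ^ i + q ^ j)%N) = 0.
  by rewrite -coefp p0 coef0.
have eqF m n : (m < n)%N || (n < m)%N -> (m == n) = false.
  by rewrite -neq_ltn => /negbTE.
split.
- by have:= c 0%N; rewrite eqxx !eqF ?subr0 ?addr0 //; lia.
- have := c (q ^ i)%N; rewrite eqxx !eqF ?subr0 ?addr0 ?sub0r; try lia.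
  by move/eqP; rewrite oppr_eq0 => /eqP.
- have := c (q ^ j)%N; rewrite eqxx !eqF ?subr0 ?addr0 ?sub0r; try lia.
  by move/eqP; rewrite oppr_eq0 => /eqP.
by have := c (q ^ i + q ^ j)%N; rewrite eqxx !eqF ?subr0 ?addr0 ?add0r //; lia.
Qed.

End NormOne.

(** * Lines meeting every extended plane of a cover *)

Section Transversals.
Variables (F : finFieldType) (L : fieldExtType F) (tau : L).
Notation q := #|F|.
Hypothesis tau_prim : (q ^ 3).-1.-primitive_root tau.

(** Let w1, w2 span the line g. For each k the three functionals a i - k^(q^i) b
    i have a common zero on g, so any two of them are proportional there; as k
    varies, [bilinear_vanishing_on_norm_one] makes each of a i, b i proportional
    on g to each of a j, b j for i <> j. All six cannot be proportional, since
    they separate the points of g, so some a i0, b i0 are independent on g, and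
    then a j and b j, proportional to both, vanish on g. *)
Lemma transversal_in_summand n (a b : 'I_3 -> 'rV[L]_n)
    (g : {vspace 'cV[L]_n}) :
    \dim g = 2%N ->
    (forall w, w \in g -> (forall i, a i *m w = 0 /\ b i *m w = 0) -> w = 0) ->
    (forall k : L, k ^+ (q ^ 2 + q + 1) = 1 ->
       exists w, [/\ w \in g, w != 0
         & forall i : 'I_3, a i *m w = frob i k *: (b i *m w)]) ->
  exists i0, forall w, w \in g -> forall j, j != i0 ->
    a j *m w = 0 /\ b j *m w = 0.
Proof.
move=> dg inj_ab meets.
have [w1 [w2 [gw1 gw2 span_g free_g]]] := dim2_basis dg.
pose fam (c : bool) i := if c then a i else b i.
pose ev (f : 'rV[L]_n) (w : 'cV[L]_n) := (f *m w) 0 0.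
pose det f h := ev f w1 * ev h w2 - ev f w2 * ev h w1.
have ev0 f w : (f *m w = 0) <-> (ev f w = 0).
  split=> [|fw0]; first by rewrite /ev => ->; rewrite mxE.
  by apply/matrixP => r s; rewrite !ord1 [LHS]fw0 mxE.
have evD f x y : ev f (x *: w1 + y *: w2) = x * ev f w1 + y * ev f w2.
  by rewrite /ev mulmxDr -!scalemxAr !mxE.
have detC f h : det h f = - det f h by rewrite /det; ring.
(* Bilinearity of det: the determinant of the functionals for i and j is a
   combination of 1, k^(q^i), k^(q^j) and their product. *)
have det_lt c d (i j : 'I_3) : (i < j)%N -> det (fam c i) (fam d j) = 0.
  move=> lt_ij.
  suff [e00 e10 e01 e11] : [/\ det (a i) (a j) = 0, det (b i) (a j) = 0,
      det (a i) (b j) = 0 & det (b i) (b j) = 0] by case: c; case: d.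
  apply: (bilinear_vanishing_on_norm_one tau_prim (i := i) (j := j)).
    by rewrite lt_ij ltn_ord.
  move=> k /meets[w [/span_g[x [y ->]] w0 abw]].
  have eqk r : x * (ev (a r) w1 - frob r k * ev (b r) w1)
             + y * (ev (a r) w2 - frob r k * ev (b r) w2) = 0.
    have := congr1 (fun M : 'M_1 => M 0 0) (abw r); rewrite /= [RHS]mxE.
    rewrite -[LHS]/(ev _ _) -[X in _ = _ * X]/(ev _ _) !evD => /eqP.
    by rewrite -subr_eq0 => /eqP e; rewrite -[RHS]e; ring.
  have xy0 : (x != 0) || (y != 0).
    apply: contraNT w0; rewrite negb_or !negbK => /andP[/eqP-> /eqP->].
    by rewrite !scale0r addr0.
  by rewrite -[RHS](det2_eq0 (eqk i) (eqk j) xy0) /det; ring.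
have det_neq c d i j : i != j -> det (fam c i) (fam d j) = 0.
  rewrite neq_ltn => /orP[|lt_ji]; first exact: det_lt.
  by rewrite detC det_lt ?oppr0.
have w1_neq0 : w1 != 0.
  apply/eqP => w10; have [] := free_g 1 0; first
    by rewrite w10 scaler0 scale0r addr0.
  by move/eqP; rewrite oner_eq0.
have [[i0 det0]|no_i0] := pselect (exists i, det (a i) (b i) != 0).
  exists i0 => w gw j ji0.
  have famj c : fam c j *m w = 0.
    have [x [y ->]] := span_g w gw; apply/ev0; rewrite evD.
    have h1 := det_neq true c i0 j; have h2 := det_neq false c i0 j.
    rewrite eq_sym in ji0; move: h1 h2 => /(_ ji0) h1 /(_ ji0) h2.
    rewrite /= in h1 h2.
    (* Cramer: a functional on g is determined by its determinants with the
       independent pair a i0, b i0. *)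
    have e1 : det (a i0) (b i0) * ev (fam c j) w1 = 0.
      have -> : det (a i0) (b i0) * ev (fam c j) w1 =
        det (a i0) (fam c j) * ev (b i0) w1
        - det (b i0) (fam c j) * ev (a i0) w1.
        by rewrite /det; ring.
      by rewrite h1 h2 !mul0r subr0.
    have e2 : det (a i0) (b i0) * ev (fam c j) w2 = 0.
      have -> : det (a i0) (b i0) * ev (fam c j) w2 =
        det (a i0) (fam c j) * ev (b i0) w2
        - det (b i0) (fam c j) * ev (a i0) w2.
        by rewrite /det; ring.
      by rewrite h1 h2 !mul0r subr0.
    move/eqP: e1; rewrite mulf_eq0 (negPf det0) => /eqP->.
    by move/eqP: e2; rewrite mulf_eq0 (negPf det0) => /eqP->;
      rewrite !mulr0 addr0.
  by split; [apply: (famj true)|apply: (famj false)].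
(* Otherwise all six functionals are proportional on g, and the kernel of a
   non-zero one is killed by all of them. *)
have det_all c d i j : det (fam c i) (fam d j) = 0.
  have [<-|/det_neq//] := eqVneq i j.
  have detab : det (a i) (b i) = 0.
    by apply/eqP; apply: contra_notT no_i0 => nz; exists i.
  case: c; case: d => //=; rewrite ?[det (b i) (a i)]detC ?detab ?oppr0 //.
    by rewrite /det mulrC subrr.
  by rewrite /det mulrC subrr.
case/eqP: w1_neq0; apply: (inj_ab) => // i.
have fam0 c : fam c i *m w1 = 0.
  apply/ev0; pose f := fam c i.
  have : ev f w2 *: w1 + (- ev f w1) *: w2 = 0.
    apply: (inj_ab) => [|j]; first by rewrite rpredD ?rpredZ.
    have z d : fam d j *m (ev f w2 *: w1 + - ev f w1 *: w2) = 0.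
      by apply/ev0; rewrite evD -[RHS]oppr0 -[in RHS](det_all c d i j) /det
        -/f; ring.
    by split; [apply: (z true)|apply: (z false)].
  by case/free_g => _ /eqP; rewrite oppr_eq0 => /eqP.
by split; [apply: (fam0 true)|apply: (fam0 false)].
Qed.

End Transversals.

(** * Frobenius coordinates *)

Lemma ltn_exp_pred_cube q k : (1 < q)%N -> (k <= 2)%N -> (q ^ k < (q ^ 3).-1)%N.
Proof.
move=> q1 k2; have: (q ^ k <= q ^ 2)%N by rewrite leq_exp2l.
have: (2 ^ 2 <= q ^ 2)%N by rewrite leq_exp2r.
by rewrite (expnS q 2); nia.
Qed.

Section FrobeniusCoordinates.
Variables (F : finFieldType) (L : fieldExtType F) (tau : L).
Notation q := #|F|.
Notation emb := (map_mx (in_alg L)).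
Hypothesis dimL : \dim {:L} = 3%N.
Hypothesis tau_prim : (q ^ 3).-1.-primitive_root tau.

Definition tau_powers : 'rV[L]_3 := \row_j tau ^+ j.

(** The change from the F-coordinates of x in the basis (1, tau, tau^2) to (x,
    x^q, x^(q^2)). *)
Definition moore : 'M[L]_3 := \matrix_(i < 3, j < 3) frob i (tau ^+ j).

Definition frobvec (t : L) : 'cV[L]_3 := \col_(i < 3) frob i t.

Definition elt (u : 'cV[F]_3) : L := \sum_(i < 3) u i 0 *: tau ^+ i.

Lemma frobvec0 t : frobvec t 0 0 = t. Proof. by rewrite mxE frob0. Qed.
Lemma frobvec1 t : frobvec t 1 0 = frob 1 t. Proof. by rewrite mxE. Qed.
Lemma frobvec2 t : frobvec t ord_max 0 = frob 2 t. Proof. by rewrite mxE. Qed.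

(** The transpose is the Vandermonde matrix of the three conjugates of tau,
    which are distinct since q^i < q^3 - 1 for i < 3. *)
Lemma moore_unit : moore \in unitmx.
Proof.
have q1 := finNzRing_gt1 F.
have -> : moore = (Vandermonde 3 (\row_(i < 3) frob i tau))^T.
  by apply/matrixP => i j; rewrite !mxE rmorphXn.
rewrite unitmxE det_tr det_Vandermonde unitfE.
apply/prodf_neq0 => i _; apply/prodf_neq0 => j lt_ij.
have lt_q (k : 'I_3) : (q ^ k < (q ^ 3).-1)%N.
  by rewrite ltn_exp_pred_cube // -ltnS ltn_ord.
rewrite subr_eq0 !mxE (eq_prim_root_expr tau_prim) !modn_small //.
by rewrite eqn_exp2l // gtn_eqF.
Qed.

Lemma tau_powers_emb u : tau_powers *m emb u = (elt u)%:M.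
Proof.
apply/matrixP => i j; rewrite !ord1 !mxE eqxx mulr1n; apply: eq_bigr => k _.
by rewrite !mxE mulr_algr.
Qed.

Lemma row_moore i : row i moore = map_mx (frob i) tau_powers.
Proof. by apply/rowP => j; rewrite !mxE. Qed.

Lemma moore_emb u : moore *m emb u = frobvec (elt u).
Proof.
apply/row_matrixP => i;
  rewrite row_mul row_moore -(map_frob_emb L i u) -map_mxM.
by rewrite tau_powers_emb; apply/matrixP => r s; rewrite !ord1 !mxE mulr1n.
Qed.

Lemma elt_eq0 u : elt u = 0 -> u = 0.
Proof.
move=> u0; have: emb u = 0.
  rewrite -(mulKmx moore_unit (emb u)) moore_emb u0.
  by rewrite (_ : frobvec 0 = 0) ?mulmx0 //; apply/colP => i;
    rewrite !mxE rmorph0.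
by move/eqP; rewrite map_mx_eq0 => /eqP.
Qed.

Lemma elt_is_linear : linear elt.
Proof.
move=> a u v; rewrite /elt scaler_sumr -big_split; apply: eq_bigr => i _ /=.
by rewrite !mxE scalerDl scalerA.
Qed.

Lemma tau_powers_free : free [tuple 1; tau; tau ^+ 2].
Proof.
apply/freeP => k k0.
have: elt (\col_i k i) = 0.
  rewrite -k0; apply: eq_bigr => i _; rewrite mxE; congr (_ *: _).
  by move: i; apply: ord3P; rewrite /= ?expr0 ?expr1.
by move/elt_eq0/colP => u0 i; have := u0 i; rewrite !mxE.
Qed.

Lemma coordsK : cancel (coords tau) elt.
Proof.
move=> a; have: basis_of {:L} [tuple 1; tau; tau ^+ 2].
  by rewrite basisEfree tau_powers_free subvf dimL.
move/coord_basis => /(_ a (memvf a)) {2}->; apply: eq_bigr => i _.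
rewrite mxE; congr (_ *: _).
by move: i; apply: ord3P; rewrite /= ?expr0 ?expr1.
Qed.

Lemma coords_eq0 a : coords tau a = 0 -> a = 0.
Proof.
move=> a0; rewrite -[a]coordsK a0 /elt big1 // => i _.
by rewrite mxE scale0r.
Qed.

Lemma quadform_emb (A : 'M[F]_3) u :
  quadform (emb A) (emb u) = in_alg L (quadform A u).
Proof. by rewrite /quadform map_trmx -!map_mxM mxE. Qed.

Definition cycle3 : 'S_3 := perm (addIr (1 : 'I_3)).

Lemma map_frob_moore : map_mx (frob 1) moore = perm_mx cycle3 *m moore.
Proof.
rewrite -row_permE; apply/matrixP => i j; rewrite !mxE permE frob_frob.
move: i; apply: ord3P => //=.
by rewrite frob3 // frob0.
Qed.

(** Quadratic forms defined over F are recognized in Frobenius coordinates: the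
    Frobenius map permutes the rows of the Moore matrix cyclically, so it fixes
    W^T D W exactly when it maps D to its cyclic shift. *)
Lemma moore_formP (D : 'M[L]_3) :
  (exists A : 'M[F]_3, emb A = moore^T *m D *m moore) <->
  (forall i j, frob 1 (D i j) = D (i + 1) (j + 1)).
Proof.
pose P : 'M[L]_3 := perm_mx cycle3.
have eqP' : (map_mx (frob 1) D = P *m D *m P^T) <->
            (forall i j, frob 1 (D i j) = D (i + 1) (j + 1)).
  rewrite tr_perm_mx -col_permE -row_permE.
  split=> [/matrixP e i j|e]; last by apply/matrixP => i j; rewrite !mxE !permE.
  by have := e i j; rewrite !mxE !permE.
have PtP : P^T *m P = 1%:M by rewrite tr_perm_mx -perm_mxM mulVg perm_mx1.
have PPt : P *m P^T = 1%:M by rewrite tr_perm_mx -perm_mxM mulgV perm_mx1.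
have fE : map_mx (frob 1) (moore^T *m D *m moore) =
    moore^T *m (P^T *m map_mx (frob 1) D *m P) *m moore.
  by rewrite !map_mxM /= -map_trmx map_frob_moore trmx_mul !mulmxA.
rewrite -eqP'; split=> [[A eA]|fD].
  move: fE; rewrite -eA map_frob_emb eA.
  have Wtu : moore^T \in unitmx by rewrite unitmx_tr moore_unit.
  move/(can_inj (mulmxK moore_unit))/(can_inj (mulKmx Wtu)) => {2}->.
  by rewrite !mulmxA PPt mul1mx -mulmxA PPt mulmx1.
apply: emb_frob_fixed; rewrite fE fD; congr (_ *m _ *m _).
by rewrite !mulmxA PtP mul1mx -mulmxA PtP mulmx1.
Qed.

End FrobeniusCoordinates.

(** * Trace forms *)

Section InverseTraceForm.
Variables (F : finFieldType) (L : fieldExtType F) (tau : L).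
Notation q := #|F|.
Notation emb := (map_mx (in_alg L)).
Hypothesis dimL : \dim {:L} = 3%N.
Hypothesis tau_prim : (q ^ 3).-1.-primitive_root tau.

Definition trace3 (x : L) : L := x + frob 1 x + frob 2 x.

(** A linear form over F, written in Frobenius coordinates, has coefficients
    that the Frobenius map permutes cyclically, so it is determined by the
    first. *)
Lemma moore_functional (p : 'cV[F]_3) : p != 0 ->
  exists2 gamma, gamma != 0
  & forall u, in_alg L ((u^T *m p) 0 0) = trace3 (gamma * elt tau u).
Proof.
move=> p0; have Wu := moore_unit tau_prim.
have [rho rhoW] : exists rho : 'rV_3, rho *m moore tau = (emb p)^T.
  by exists ((emb p)^T *m invmx (moore tau)); rewrite mulmxKV.
have rhoP : rho = map_mx (frob 1) rho *m perm_mx cycle3.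
  apply: (can_inj (mulmxK Wu));
    rewrite -mulmxA -map_frob_moore // -map_mxM rhoW.
  by rewrite map_trmx map_frob_emb.
have rho_next j : rho 0 (j + 1) = frob 1 (rho 0 j).
  have : col_perm cycle3 rho = map_mx (frob 1) rho.
    by rewrite col_permE {1}rhoP -mulmxA -perm_mxM mulgV perm_mx1 mulmx1.
  by move/matrixP/(_ 0 j); rewrite !mxE permE.
have rho1 : rho 0 1 = frob 1 (rho 0 0) by rewrite -rho_next add0r.
have rho2 : rho 0 ord_max = frob 2 (rho 0 0).
  rewrite -[frob 2 _]/(frob (1 + 1) _) -frob_frob -!rho_next.
  by congr (rho 0 _); apply: val_inj.
exists (rho 0 0).
  apply: contraNneq p0 => r0; rewrite -(map_mx_eq0 (in_alg L)) -trmx_eq0 -rhoW.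
  suff -> : rho = 0 by rewrite mul0mx.
  by apply/rowP; apply: ord3P; rewrite ?rho1 ?rho2 r0 ?rmorph0 mxE.
move=> u; have -> : in_alg L ((u^T *m p) 0 0) = ((emb p)^T *m emb u) 0 0.
  by rewrite map_trmx -map_mxM [RHS]mxE; congr (in_alg L _); rewrite !dot_cV;
    ring.
rewrite -rhoW -mulmxA moore_emb // mxE big_ord3 frobvec0 frobvec1 frobvec2.
by rewrite rho1 rho2 /trace3 !rmorphM.
Qed.

(** The form is d x^q x^(q^2) + d^q x^(q^2) x + d^(q^2) x x^q, which is N (x) Tr
    (d / x) and has no square terms in Frobenius coordinates. If x is in the
    radical of its polar form, the coefficients of y^q and y^(q^2) give x^q = -
    d^q x / d and x^(q^2) = - d^(q^2) x / d; the value of the form at x is then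
    - d^q d^(q^2) x^2 / d, which is non-zero, in every characteristic. *)
Lemma inverse_trace_form (d : L) : d != 0 ->
  exists A : 'M[F]_3,
  [/\ Defs.nondegenerate A,
      forall u, u != 0 -> quadform A u = 0 <-> trace3 (d / elt tau u) = 0
    & forall i v, moore tau *m v = delta_mx i 0 -> quadform (emb A) v = 0].
Proof.
move=> d0.
(* The monomial at (i, i + 1) is the product of all coordinates but the one of
   index i + 2 modulo 3; its coefficient is the conjugate of d with that index.
   *)
pose D : 'M[L]_3 := \matrix_(i, j) (if j == i + 1 then frob (i + 2) d else 0).
have [A eA] : exists A : 'M[F]_3, emb A = (moore tau)^T *m D *m moore tau.
  apply/(moore_formP dimL tau_prim) => i j; rewrite !mxE (inj_eq (addIr _)).
  case: eqP => _; last by rewrite rmorph0.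
  rewrite frob_frob; move: i; apply: ord3P => //=.
  by rewrite (frobD3 dimL 2).
have DE v : quadform D v = frob 2 d * (v 0 0 * v 1 0)
    + d * (v 1 0 * v ord_max 0) + frob 1 d * (v ord_max 0 * v 0 0).
  rewrite quadformE !mxE /=.
  by rewrite (frobD3 dimL 0) (frobD3 dimL 1) frob0; ring.
have AE u (x := elt tau u) : in_alg L (quadform A u) =
    frob 2 d * (x * frob 1 x) + d * (frob 1 x * frob 2 x)
      + frob 1 d * (frob 2 x * x).
  rewrite -quadform_emb eA quadform_congr moore_emb //.
  by rewrite DE frobvec0 frobvec1 frobvec2.
have fd i : frob i d != 0 by rewrite fmorph_eq0.
exists A; split=> [v v0 Qv0 rad|u u0|i v Wv]; first last.
- rewrite eA quadform_congr Wv DE !mxE; move: i {Wv}.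
  by apply: ord3P; rewrite /= !(mulr0, mul0r, addr0).
- have x0 : elt tau u != 0 by apply: contraNneq u0 => /(elt_eq0 tau_prim)->.
  have fx i : frob i (elt tau u) != 0 by rewrite fmorph_eq0.
  have e : in_alg L (quadform A u) =
      elt tau u * frob 1 (elt tau u) * frob 2 (elt tau u)
        * trace3 (d / elt tau u).
    by rewrite AE /trace3 !fmorph_div; field; rewrite x0 !fx.
  split=> [Q0|T0].
    move/eqP: e; rewrite Q0 rmorph0 eq_sym !mulf_eq0 (negPf x0) !(negPf (fx _))
      /=.
    by move/eqP.
  by apply: (fmorph_inj (in_alg L)); rewrite rmorph0; apply: etrans e _;
    rewrite T0 mulr0.
pose x := elt tau v.
have x0 : x != 0 by apply: contraNneq v0 => /(elt_eq0 tau_prim)->.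
(* The linear form polar to v, in Frobenius coordinates; it vanishes on F^3,
   hence identically since the Moore matrix is invertible. *)
pose l : 'rV[L]_3 := \row_(i < 3)
  [:: frob 2 d * frob 1 x + frob 1 d * frob 2 x;
      frob 2 d * x + d * frob 2 x; d * frob 1 x + frob 1 d * x]`_i.
have l_eq0 : l = 0.
  apply: (can_inj (mulmxK (moore_unit tau_prim))); rewrite mul0mx.
  apply/rowP => j; rewrite [RHS]mxE.
  pose w : 'cV[F]_3 := delta_mx j 0.
  have -> : (l *m moore tau) 0 j = (l *m (moore tau *m emb w)) 0 0.
    by rewrite mulmxA map_delta_mx -colE [RHS]mxE.
  rewrite moore_emb // mxE big_ord3 frobvec0 frobvec1 frobvec2 !mxE /=.
  have : in_alg L (quadform A (v + w)) =
      in_alg L (quadform A v) + in_alg L (quadform A w) by rewrite rad rmorphD.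
  rewrite !AE /= -/x.
  have -> : elt tau (v + w) = x + elt tau w.
    by have := elt_is_linear tau 1 v w; rewrite !scale1r.
  rewrite !rmorphD /= => /eqP; rewrite -subr_eq0 => /eqP e.
  by rewrite -[RHS]e; ring.
have l1 : frob 2 d * x + d * frob 2 x = 0.
  by move/rowP/(_ 1): l_eq0; rewrite !mxE.
have l2 : d * frob 1 x + frob 1 d * x = 0.
  by move/rowP/(_ ord_max): l_eq0; rewrite !mxE.
have x1 : frob 1 x = - (frob 1 d * x / d).
  by apply: (mulfI d0); rewrite mulrN mulrCA divff // mulr1; apply/eqP;
    rewrite -addr_eq0 l2.
have x2 : frob 2 x = - (frob 2 d * x / d).
  apply: (mulfI d0); rewrite mulrN mulrCA divff // mulr1; apply/eqP.
  by rewrite -addr_eq0 addrC l1.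
have := AE v; rewrite Qv0 rmorph0 /= -/x x1 x2 => /esym e.
have : frob 1 d * frob 2 d * x ^+ 2 = 0.
  by transitivity (- d * 0); [rewrite -e; field | rewrite mulr0].
by move/eqP; rewrite !mulf_eq0 !(negPf (fd _)) (negPf x0).
Qed.

(** If c^(q-1) = k then c works for n = 1, and c^(-q) for n = 2, because
    (c^(-q))^(q^2-1) = c^(q-q^3) = c^(q-1). *)
Lemma frob_hilbert90 n (k : L) :
  (n == 1%N) || (n == 2%N) -> k ^+ (q ^ 2 + q + 1) = 1 ->
  exists2 c, c != 0 & frob n c = k * c.
Proof.
move=> n12 /(norm_one_hilbert90 tau_prim)[c c0 ck].
have fc : frob 1 c = k * c.
  by rewrite -ck -exprSr prednK // ltnW // finNzRing_gt1.
case/orP: n12 => /eqP->; first by exists c.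
exists (frob 1 c)^-1; first by rewrite invr_eq0 fmorph_eq0.
have k0 : k != 0.
  by apply: contraNneq c0 => k0; move/eqP: fc; rewrite k0 mul0r fmorph_eq0.
by rewrite fmorphV /= frob_frob (frob3 dimL) fc invfM mulVKf.
Qed.

Lemma frob_fixed n (x : L) : (n == 1%N) || (n == 2%N) -> frob n x = x ->
  exists a : F, x = a%:A.
Proof.
case/orP => /eqP-> fx; first exact: frob1_fixed.
by apply: frob1_fixed; rewrite -{1}fx frob_frob (frob3 dimL).
Qed.

Lemma trace3Z (a : F) x : trace3 (a%:A * x) = a%:A * trace3 x.
Proof. by rewrite /trace3 !rmorphM /= !frob_alg !mulrDr. Qed.

End InverseTraceForm.

(** * The hyperplane at infinity in Frobenius coordinates *)

Section BruckBoseCovers.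
Variables (F : finFieldType) (L : fieldExtType F) (tau : L).
Notation q := #|F|.
Notation emb := (map_mx (in_alg L)).
Hypothesis dimL : \dim {:L} = 3%N.
Hypothesis tau_prim : (q ^ 3).-1.-primitive_root tau.

Definition infvec (x y : L) : 'cV[L]_3 :=
  mx_of_rows 3 1 [:: [:: x]; [:: y]; [:: 0]].

Lemma infvec0 x y : infvec x y 0 0 = x. Proof. by rewrite mxE. Qed.
Lemma infvec1 x y : infvec x y 1 0 = y. Proof. by rewrite mxE. Qed.
Lemma infvec2 x y : infvec x y ord_max 0 = 0. Proof. by rewrite mxE. Qed.

Lemma infvec_eta (v : 'cV[L]_3) : v ord_max 0 = 0 -> v = infvec (v 0 0) (v 1 0).
Proof.
by move=> v2; apply/colP; apply: ord3P; rewrite ?infvec0 ?infvec1 ?infvec2.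
Qed.

Lemma infvecZ c x y : c *: infvec x y = infvec (c * x) (c * y).
Proof. by apply/colP; apply: ord3P; rewrite !mxE //= mulr0. Qed.

Lemma bruck_bose_linear (a : F) (u v : 'cV[L]_3) :
  bruck_bose tau (a%:A *: u + v) = a *: bruck_bose tau u + bruck_bose tau v.
Proof.
have entry i : (a%:A *: u + v) i 0 = a *: u i 0 + v i 0.
  by rewrite 2!mxE mulr_algl.
rewrite /bruck_bose !entry !coords_is_linear.
apply/colP => i; rewrite !mxE; case: (@split 6 1 i) => j; last
  by rewrite !mxE mulr0 addr0.
by rewrite !mxE; case: (@split 3 3 j) => l; rewrite !mxE.
Qed.

Lemma bruck_bose_last (u : 'cV[L]_3) : bruck_bose tau u ord_max 0 = 0.
Proof.
rewrite /bruck_bose (_ : ord_max = rshift (3 + 3) (0 : 'I_1));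
  last exact: val_inj.
by apply: etrans (@col_mxEd _ 6 1 1 _ _ _ _) _; rewrite mxE.
Qed.

Lemma extend_sub n p (M : 'M[L]_(p, n)) (U : {vspace 'cV[F]_n}) :
  (forall v, v \in U -> M *m emb v = 0) ->
  forall w, w \in extend L U -> M *m w = 0.
Proof.
move=> MU w; have/subvP sub : (extend L U <= lker (linfun (mulmx M :
  'cV_n -> 'cV_p)))%VS.
  apply/span_subvP => _ /mapP[u Uu ->].
  by rewrite memv_ker lfunE /= MU // vbasis_mem.
by move/sub; rewrite memv_ker lfunE => /eqP.
Qed.

Lemma extend_infinity w :
  w \in extend L (hyperplane_at_infinity F 6) -> w ord_max 0 = 0.
Proof.
move=> win; have := @extend_sub _ 1 (delta_mx 0 ord_max)
  (hyperplane_at_infinity F 6) _ w win.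
rewrite -rowE => /(_ _) H.
have /rowP/(_ 0) : row ord_max w = 0.
  apply: H => v; rewrite mem_infinity -rowE => /eqP v0.
  by apply/rowP => j; rewrite !mxE ord1 v0 rmorph0.
by rewrite !mxE.
Qed.

Variable Phi : 'M[L]_3.
Hypothesis Phi_unit : Phi \in unitmx.
Hypothesis Phi_last : forall v : 'cV[L]_3, (Phi *m v) ord_max 0 = v ord_max 0.

(** The point of the hyperplane at infinity that the map induced by Phi assigns
    to ([x], [y], 0). *)
Definition bose_image (x y : L) : 'cV[F]_7 :=
  bruck_bose tau (Phi *m infvec x y).

Lemma bose_image_linear (a : F) x y x' y' :
  bose_image (a *: x + x') (a *: y + y') = a *: bose_image x y
    + bose_image x' y'.
Proof.
rewrite /bose_image -bruck_bose_linear scalemxAr -mulmxDr;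
  congr (bruck_bose _ (_ *m _)).
apply/colP; apply: ord3P; rewrite !mxE /= ?mulr_algl //.
by rewrite scaler0 addr0.
Qed.

Let Psi := invmx Phi.

Lemma Psi_last (v : 'cV[L]_3) : (Psi *m v) ord_max 0 = v ord_max 0.
Proof. by rewrite -[in RHS](mulKVmx Phi_unit v) Phi_last. Qed.

Lemma Phi_Psi (s t : 'I_3) : t != ord_max ->
  Phi s 0 * Psi 0 t + Phi s 1 * Psi 1 t = (s == t)%:R.
Proof.
move=> tm; have := congr1 (fun M : 'M_3 => M s t) (mulmxV Phi_unit).
rewrite /= mxE big_ord3 [RHS]mxE => <-.
have -> : invmx Phi ord_max t = 0; last by rewrite mulr0 addr0.
have := Psi_last (delta_mx t 0); rewrite -colE !mxE => ->.
by rewrite eq_sym (negPf tm).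
Qed.

(** Over L, the linear forms that recover x (r = 0) and y (r = 1) from the image
    of ([x], [y], 0); their Frobenius conjugates recover the conjugates. *)
Definition affine_coord (r : 'I_3) : 'rV[L]_7 :=
  row_mx (row_mx (Psi r 0 *: tau_powers tau) (Psi r 1 *: tau_powers tau))
    (0 : 'rV_1).

Lemma affine_coord_bose_image r i x y :
  map_mx (frob i) (affine_coord r) *m emb (bose_image x y)
  = (frob i (infvec x y r 0))%:M.
Proof.
rewrite -(map_frob_emb L i) -map_mxM.
suff -> : affine_coord r *m emb (bose_image x y) = (infvec x y r 0)%:M.
  by apply/matrixP => s t; rewrite !ord1 !mxE mulr1n.
rewrite /bose_image /bruck_bose; set u := Phi *m infvec x y.
have -> : emb (bruck_bose tau u) = @col_mx _ 6 1 1
    (@col_mx _ 3 3 1 (emb (coords tau (u 0 0))) (emb (coords tau (u 1 0)))) 0.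
  apply: etrans (@map_col_mx _ _ _ 6 1 1 _ _) _.
  by rewrite (@map_col_mx _ _ _ 3 3 1) map_mx0.
rewrite /affine_coord (@mul_row_col _ 1 6 1 1) (@mul_row_col _ 1 3 3 1) mul0mx
  addr0.
rewrite -!scalemxAl !tau_powers_emb !(coordsK dimL tau_prim).
have -> : infvec x y r 0 = Psi r 0 * u 0 0 + Psi r 1 * u 1 0.
  rewrite -[infvec x y](mulKmx Phi_unit) -/u mxE big_ord3.
  by rewrite [u ord_max 0]Phi_last infvec2 mulr0 addr0.
by apply/matrixP => s t; rewrite !ord1 !mxE !mulr1n.
Qed.

Lemma bose_image_inj x y x' y' : bose_image x y = bose_image x' y' ->
  x = x' /\ y = y'.
Proof.
move=> e.
have H r : infvec x y r 0 = infvec x' y' r 0.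
  have := affine_coord_bose_image r 0 x y;
    rewrite e affine_coord_bose_image !frob0.
  by move/matrixP/(_ 0 0); rewrite !mxE !mulr1n.
by have := H 0; have := H 1; rewrite !infvec0 !infvec1.
Qed.

Lemma bose_image00 : bose_image 0 0 = 0.
Proof.
have := bose_image_linear (-1) 0 0 0 0.
by rewrite !scaler0 !addr0 scaleN1r addNr.
Qed.

Lemma bose_image_neq0 x y : (x != 0) || (y != 0) -> bose_image x y != 0.
Proof.
apply: contraTneq => xy0; have := @bose_image_inj x y 0 0.
by rewrite xy0 bose_image00 => /(_ erefl)[-> ->]; rewrite eqxx.
Qed.

(** The six conjugate forms are coordinates on the extended hyperplane: undo
    Phi, then the Moore matrix. *)
Lemma affine_coords_eq0 (w : 'cV[L]_7) : w ord_max 0 = 0 ->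
  (forall (i r : 'I_3), r != ord_max ->
     map_mx (frob i) (affine_coord r) *m w = 0) -> w = 0.
Proof.
have -> : w = col_mx (col_mx (usubmx (usubmx (w : 'cV_(3 + 3 + 1))))
    (dsubmx (usubmx (w : 'cV_(3 + 3 + 1))))) (dsubmx (w : 'cV_(3 + 3 + 1))).
  by rewrite !vsubmxK.
set x := usubmx _; set y := dsubmx (usubmx _); set z := dsubmx _ => w6 fw.
have z0 : z = 0.
  apply/colP => i; rewrite ord1 [RHS]mxE -[RHS]w6.
  rewrite (_ : ord_max = rshift (3 + 3) (0 : 'I_1)); last exact: val_inj.
  exact: esym (@col_mxEd _ 6 1 1 _ _ _ _).
have eqs (i r : 'I_3) : r != ord_max ->
    frob i (Psi r 0) * (moore tau *m x) i 0
      + frob i (Psi r 1) * (moore tau *m y) i 0 = 0.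
  move=> rm; have := fw i r rm.
  rewrite /affine_coord (@map_row_mx _ _ _ 1 6 1) (@map_row_mx _ _ _ 1 3 3).
  rewrite (@mul_row_col _ 1 6 1 1) (@mul_row_col _ 1 3 3 1) z0 mulmx0 addr0.
  rewrite !map_mxZ -!row_moore -!scalemxAl -!row_mul.
  by move/matrixP/(_ 0 0); rewrite !mxE.
have key (s i : 'I_3) : s != ord_max ->
    (s == 0)%:R * (moore tau *m x) i 0 + (s == 1)%:R * (moore tau *m y) i 0 = 0.
  move=> sm; rewrite -(rmorph_nat (frob i) (s == 0)).
  rewrite -(rmorph_nat (frob i) (s == 1)).
  rewrite -!Phi_Psi // !rmorphD !rmorphM /=.
  have e0 := eqs i 0 isT; have e1 := eqs i 1 isT.
  have -> : forall a b c d e f g h : L,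
    (a * b + c * d) * e + (a * f + c * g) * h
     = a * (b * e + f * h) + c * (d * e + g * h) by move=> *; ring.
  by rewrite e0 e1 !mulr0 addr0.
have inv0 (v : 'cV_3) : moore tau *m v = 0 -> v = 0.
  by move=> v0; rewrite -(mulKmx (moore_unit tau_prim) v) v0 mulmx0.
have -> : x = 0.
  by apply/inv0/colP => i; have := key 0 i isT;
    rewrite !mul1r mul0r addr0 => ->; rewrite mxE.
have -> : y = 0.
  by apply/inv0/colP => i; have := key 1 i isT;
    rewrite !mul1r mul0r add0r => ->; rewrite mxE.
by rewrite z0 !col_mx0.
Qed.

End BruckBoseCovers.

(** * The covers and the 2-regulus of a subline *)

Section CoverConics.
Variables (F : finFieldType) (L : fieldExtType F) (tau : L).
Notation q := #|F|.
Notation emb := (map_mx (in_alg L)).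
Hypothesis dimL : \dim {:L} = 3%N.
Hypothesis tau_prim : (q ^ 3).-1.-primitive_root tau.
Variable Phi : 'M[L]_3.
Hypothesis Phi_unit : Phi \in unitmx.
Hypothesis Phi_last : forall v : 'cV[L]_3, (Phi *m v) ord_max 0 = v ord_max 0.
Variable n : nat.
Hypothesis n12 : (n == 1%N) || (n == 2%N).

Notation bb := (bose_image tau Phi).
Notation cov := (cover_plane tau Phi (q ^ n)).
Notation norm_one := [set k : L | k ^+ (q ^ 2 + q + 1) = 1].

Lemma mem_cover k v :
  reflect (exists x, v = bb (k * x) (frob n x)) (v \in cov k).
Proof. exact: cover_planeP. Qed.

Lemma Phi_infvec_neq0 x y : y != 0 -> Phi *m infvec x y != 0.
Proof.
apply: contraNneq => /(congr1 (mulmx (invmx Phi))).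
by rewrite mulKmx // mulmx0 => /colP/(_ 1); rewrite infvec1 mxE => ->.
Qed.

Lemma mem_spread_plane x y v : y != 0 ->
  v \in spread_plane tau <[Phi *m infvec x y]> <->
    exists z, v = bb (z * x) (z * y).
Proof.
move=> y0; have [c c0 pc] := vpick_vline (Phi_infvec_neq0 x y0).
split=> [/spread_planeP|] [z ->].
  by exists (z * c); rewrite pc scalerA /bose_image -infvecZ scalemxAr.
apply/spread_planeP; exists (z / c).
by rewrite pc scalerA divfK // /bose_image -infvecZ scalemxAr.
Qed.

(** On the plane {(k x, x^(q^n))}, the forms [left_coord i] and [right_coord i]
    take the values k^(q^i) x^(q^i) and x^(q^i). *)
Definition left_coord (i : 'I_3) : 'rV[L]_7 :=
  map_mx (frob i) (affine_coord tau Phi 0).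

(** The exponent i + (3 - n) undoes, modulo 3, the power q^n in the second
    coordinate of a cover plane. *)
Definition right_coord (i : 'I_3) : 'rV[L]_7 :=
  map_mx (frob (i + (3 - n))) (affine_coord tau Phi 1).

Lemma left_coord_bose_image i x y : left_coord i *m emb (bb x y) =
  (frob i x)%:M.
Proof. by rewrite affine_coord_bose_image // infvec0. Qed.

Lemma right_coord_bose_image i x y :
  right_coord i *m emb (bb x (frob n y)) = (frob i y)%:M.
Proof.
rewrite affine_coord_bose_image // infvec1 frob_frob -addnA subnK ?frobD3 //.
by case/orP: n12 => /eqP->.
Qed.

Lemma extend_cover k i w : w \in extend L (cov k) ->
  left_coord i *m w = frob i k *: (right_coord i *m w).
Proof.
move=> win; apply/eqP; rewrite -subr_eq0 scalemxAl -mulmxBl; apply/eqP.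
apply: extend_sub win => _ /mem_cover[x ->].
rewrite mulmxBl -scalemxAl left_coord_bose_image right_coord_bose_image.
by rewrite scale_scalar_mx rmorphM subrr.
Qed.

Lemma twisted_coords_eq0 (w : 'cV[L]_7) : w ord_max 0 = 0 ->
  (forall i, left_coord i *m w = 0 /\ right_coord i *m w = 0) -> w = 0.
Proof.
move=> w6 w0; apply: (affine_coords_eq0 tau_prim Phi_unit Phi_last w6) => i r.
move: r; apply: ord3P => // _; first by case: (w0 i).
have shift (j : 'I_3) : map_mx (frob (i + 3)) (affine_coord tau Phi 1) =
  right_coord j ->
    map_mx (frob i) (affine_coord tau Phi 1) *m w = 0.
  move=> e; have [_ <-] := w0 j; rewrite -e; congr (_ *m _).
  by apply/matrixP => s t; rewrite !mxE frobD3.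
have mod3 (j : 'I_3) : (i + 3 = j + (3 - n) %[mod 3])%N ->
    map_mx (frob i) (affine_coord tau Phi 1) *m w = 0.
  move=> e; apply: (shift j); apply/matrixP => s t; rewrite ![LHS]mxE ![RHS]mxE.
  have frob_mod l (x : L) : frob (l %% 3) x = frob l x.
    rewrite [in RHS](divn_eq l 3) addnC; elim: (l %/ 3)%N => [|m IHm]; first
      by rewrite addn0.
    by rewrite mulSn addnCA addnC frobD3.
  by rewrite -frob_mod e frob_mod.
case/orP: n12 mod3 => /eqP-> mod3; move: i {shift} mod3; apply: ord3P => mod3.
- exact: (mod3 1).
- exact: (mod3 ord_max).
- exact: (mod3 0).
- exact: (mod3 ord_max).
- exact: (mod3 0).
exact: (mod3 1).
Qed.

(** The frame in which the conic is written: the element x of L has its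
    coordinates in the basis (1, tau, tau^2). *)
Lemma cover_frame k : exists N : 'M[F]_(7, 3),
  [/\ forall v, N *m v = bb (k * elt tau v) (frob n (elt tau v)),
      \rank N = 3%N & limg (linfun (mulmx N : 'cV_3 -> 'cV_7)) = cov k].
Proof.
have [|N NE] := @linear_mulmx F 7 3 (fun v =>
  bb (k * elt tau v) (frob n (elt tau v))).
  move=> a u v.
  have e1 : k * elt tau (a *: u + v) = a *: (k * elt tau u) + k * elt tau v.
    by rewrite elt_is_linear mulrDr scalerAr.
  have e2 : frob n (elt tau (a *: u + v)) = a *: frob n (elt tau u)
    + frob n (elt tau v).
    by rewrite elt_is_linear rmorphD -mulr_algl rmorphM /= frob_alg mulr_algl.
  by rewrite e1 e2 bose_image_linear.
have N_inj (v : 'cV_3) : N *m v = 0 -> v = 0.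
  rewrite NE -[X in _ = X -> _](bose_image00 tau Phi).
  case/(bose_image_inj dimL tau_prim Phi_unit Phi_last) => _ /eqP.
  by rewrite fmorph_eq0 => /eqP/(elt_eq0 tau_prim).
exists N; split=> //.
  rewrite -mxrank_tr; apply/eqP/inj_row_free => v /(congr1 trmx).
  rewrite trmx_mul trmxK trmx0 => /N_inj/(congr1 trmx).
  by rewrite trmxK trmx0.
apply/vspaceP => w; apply/memv_imgP/mem_cover => [[v _ ->]|[x ->]].
  by exists (elt tau v); rewrite lfunE /= NE.
by exists (coords tau x); rewrite ?memvf // lfunE /= NE (coordsK dimL tau_prim).
Qed.

(** Frobenius coordinates split the extended hyperplane into three lines, the
    i-th with the coordinates [left_coord i] and [right_coord i]. A transversal
    is one of them by [transversal_in_summand], and it meets the extended cover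
    plane of k in a coordinate point of that plane, which is on the conic. *)
Lemma transversal_meets_conic k (N : 'M[F]_(7, 3)) A g : norm_one k ->
    (forall v, N *m v = bb (k * elt tau v) (frob n (elt tau v))) ->
    (forall i v, moore tau *m v = delta_mx i 0 -> quadform (emb A) v = 0) ->
    Defs.transversal (cov @` norm_one) g ->
  exists2 X, conic (emb N) (emb A) X & (X <= g)%VS.
Proof.
move=> k1 NE A0 [dg ginf gmeets].
have g6 w : w \in g -> w ord_max 0 = 0.
  by move=> gw; apply: (@extend_infinity F L); apply: subvP gw.
have meets k' : norm_one k' -> exists w, [/\ w \in g, w != 0
    & forall i, left_coord i *m w = frob i k' *: (right_coord i *m w)].
  move=> k'1; have Ck' : (cov @` norm_one) (cov k') by exists k'.
  have := gmeets _ Ck'; rewrite -vpick0 => w0.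
  have := memv_pick (g :&: extend L (cov k'))%VS;
    rewrite memv_cap => /andP[gw kw].
  by exists (vpick (g :&: extend L (cov k'))%VS); split=> // i;
    apply: extend_cover.
have [|i0 gi0] := transversal_in_summand tau_prim dg _ meets.
  by move=> w gw; apply: twisted_coords_eq0; apply: g6.
have [w [gw w0 kw]] := meets k k1.
pose t := (right_coord i0 *m w) 0 0.
have rw : right_coord i0 *m w = t%:M.
  by apply/matrixP => r s; rewrite !ord1 [RHS]mxE mulr1n.
have [v Wv] : exists v : 'cV[L]_3, moore tau *m v = delta_mx i0 0.
  by exists (invmx (moore tau) *m delta_mx i0 0); rewrite mulKVmx // moore_unit.
have eq_emb p (M M' : 'M[L]_(p, 3)) : (forall u : 'cV_3,
  M *m emb u = M' *m emb u) -> M = M'.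
  move=> eM; apply/matrixP => r j; have := eM (delta_mx j 0).
  by rewrite !map_delta_mx -!colE => /colP/(_ r); rewrite !mxE.
have embN (u : 'cV_3) : emb N *m emb u =
  emb (bb (k * elt tau u) (frob n (elt tau u))).
  by rewrite -NE map_mxM.
have right_N i : right_coord i *m emb N = row i (moore tau).
  apply: eq_emb => u; rewrite -mulmxA embN right_coord_bose_image -row_mul
    moore_emb //.
  by apply/matrixP => r s; rewrite !ord1 !mxE mulr1n.
have left_N i : left_coord i *m emb N = frob i k *: row i (moore tau).
  apply: eq_emb => u; rewrite -mulmxA embN left_coord_bose_image.
  rewrite -scalemxAl -row_mul moore_emb //.
  by apply/matrixP => r s; rewrite !ord1 !mxE mulr1n rmorphM.
have wE : w = t *: (emb N *m v).
  apply/eqP; rewrite -subr_eq0; apply/eqP; apply: twisted_coords_eq0.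
    rewrite mxE (g6 _ gw) add0r !mxE big1 ?mulr0 ?oppr0 // => j _.
    have : (N *m (delta_mx j 0 : 'cV_3)) ord_max 0 = 0
      by rewrite NE /bose_image bruck_bose_last.
    by rewrite -colE !mxE => ->; rewrite rmorph0 mul0r.
  move=> i; have row_v : row i (moore tau) *m v = (i == i0)%:R%:M.
    by rewrite -row_mul Wv; apply/matrixP => r s;
      rewrite !ord1 !mxE andbT mulr1n.
  rewrite !mulmxBr -!scalemxAr !mulmxA right_N left_N -scalemxAl row_v.
  have [->|/(gi0 w gw)[-> ->]] := eqVneq i i0.
    by rewrite kw rw !scale_scalar_mx !mulr1 [t * _]mulrC !subrr.
  by rewrite !scale_scalar_mx !mulr0 raddf0 subrr.
have t0 : t != 0 by apply: contraNneq w0 => t0; rewrite wE t0 scale0r.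
exists <[emb N *m v]>%VS.
  exists v => //; split; last exact: A0 Wv.
  apply/eqP => v0; move: Wv; rewrite v0 mulmx0 => /colP/(_ i0).
  by rewrite !mxE !eqxx => /eqP; rewrite eq_sym oner_eq0.
by rewrite -memvE -[emb N *m v](scalerK t0) -wE rpredZ.
Qed.

(** The common form of the two kinds of sublines. *)
Definition trace_subline (gamma : L) : set {vspace 'cV[L]_3} :=
  [set <[Phi *m infvec (frob n s) s]>%VS
    | s in [set s | s != 0 /\ trace3 (gamma * s) = 0]].

(** A point (k x, x^(q^n)) of the cover plane is z (s^(q^n), s) for some z
    exactly when (x s)^(q^n - 1) = k, that is, when x s is an F-multiple of a
    fixed c with c^(q^n - 1) = k. So Tr (gamma s) = 0 becomes Tr (gamma c / x) =
    0. *)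
Lemma regulus_meets_cover_plane gamma k : gamma != 0 -> norm_one k ->
  special_conic L (cov @` norm_one) (cov k)
    (points_covered (regulus tau (trace_subline gamma)) (cov k)).
Proof.
move=> g0 k1; split; first by exists k.
have [c c0 ck] := frob_hilbert90 dimL tau_prim n12 k1.
have d0 : gamma * c != 0 by rewrite mulf_neq0.
have [A [ndA QA A0]] := inverse_trace_form dimL tau_prim d0.
have [N [NE rkN imN]] := cover_frame k.
exists N, A; split=> //; last by move=> g;
  apply: transversal_meets_conic k1 NE A0.
have elt0 (v : 'cV_3) : v != 0 -> elt tau v != 0.
  by move=> v0; apply: contraNneq v0 => /(elt_eq0 tau_prim)->.
have fi (x : L) : x != 0 -> frob n x != 0 by move=> x0; rewrite fmorph_eq0.
have N0 (v : 'cV_3) : v != 0 -> N *m v != 0.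
  by move=> /elt0 v0; rewrite NE bose_image_neq0 // orbC fi.
apply/seteqP; split=> X.
  case=> /dim1_vline[p p0 ->]; rewrite -!memvE.
  case/mem_cover => x px [_ [_ [s [s0 tr_s] <-] <-]]; rewrite -memvE.
  case/(mem_spread_plane _ _ s0) => z; rewrite px.
  case/(bose_image_inj dimL tau_prim Phi_unit Phi_last) => e1 e2.
  have x0 : x != 0.
    by apply: contraNneq p0 => x0; rewrite px x0 mulr0 rmorph0 bose_image00.
  exists (coords tau x); last by rewrite NE (coordsK dimL tau_prim).
  have v0 : coords tau x != 0
    by apply: contraNneq x0 => /(coords_eq0 dimL tau_prim)->.
  split=> //; apply/(QA _ v0); rewrite (coordsK dimL tau_prim).
  (* f is fixed by the q^n-th power map, hence lies in F. *)
  pose f := x * s / c.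
  have fx : frob n f = f.
    rewrite /f !rmorphM fmorphV /= ck e2.
    have -> : z * s * frob n s = (z * frob n s) * s by ring.
    have k0 : k != 0 by apply: contraNneq (fi c c0) => k0; rewrite ck k0 mul0r.
    by rewrite -e1; field; rewrite c0 k0.
  have [a fa] := frob_fixed dimL n12 fx.
  have a0 : a%:A != 0 :> L by rewrite -fa !mulf_neq0 ?invr_eq0.
  apply: (mulfI a0); rewrite mulr0 -trace3Z -fa -[RHS]tr_s; congr trace3.
  by rewrite /f; field; rewrite x0 c0.
case=> v [v0 Qv] <-; set x := elt tau v.
have x0 : x != 0 := elt0 v v0.
split.
- by rewrite dim_vline N0.
- by rewrite -memvE; apply/mem_cover; exists x; rewrite NE.
have s0 : c / x != 0 by rewrite mulf_neq0 ?invr_eq0.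
exists (spread_plane tau <[Phi *m infvec (frob n (c / x)) (c / x)]>).
  exists (<[Phi *m infvec (frob n (c / x)) (c / x)]>%VS) => //.
  exists (c / x) => //; split=> //.
  by move/(QA _ v0): Qv; rewrite mulrA.
rewrite -memvE; apply/(mem_spread_plane _ _ s0); exists (frob n x * x / c).
(* The factor z of (s^(q^n), s), for s = c / x, has to be x^(q^n) / s. *)
have e1 : frob n x * x / c * frob n (c / x) = k * x.
  by rewrite rmorphM fmorphV /= ck; field; rewrite c0 fi.
have e2 : frob n x * x / c * (c / x) = frob n x by field; rewrite x0 c0.
by rewrite NE e1 e2.
Qed.

End CoverConics.

(** * Lines of a subplane *)

Section Subplanes.
Variables (F : finFieldType) (L : fieldExtType F).
Notation emb := (map_mx (in_alg L)).

Lemma emb_vline n (p r : 'cV[F]_n) : emb p \in <[emb r]>%VS -> p \in <[r]>%VS.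
Proof.
case/vlineP => c pr.
have [r0|/cV0Pn[i ri]] := eqVneq r 0; apply/vlineP.
  exists 0; rewrite scale0r; apply/eqP.
  by rewrite -(map_mx_eq0 (in_alg L)) pr r0 map_mx0 scaler0.
move/colP: pr => pr.
exists (p i 0 / r i 0); apply/colP => j; rewrite mxE.
have ri' : in_alg L (r i 0) != 0 by rewrite fmorph_eq0.
apply: (fmorph_inj (in_alg L)); rewrite !rmorphM fmorphV /=.
have := pr i; have := pr j; rewrite !mxE /= => -> ->.
by rewrite mulfK.
Qed.

Variable M : 'M[L]_3.
Hypothesis M_unit : M \in unitmx.

Notation pi := (homography M @` (@base_subplane F L)).

Lemma subplaneP P : pi P <->
  exists2 v : 'cV[F]_3, v != 0 & P = <[M *m emb v]>%VS.
Proof.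
split=> [[_ [v v0 <-] <-]|[v v0 ->]]; first by exists v;
  rewrite ?homography_vline.
by exists <[emb v]>%VS; rewrite ?homography_vline //; exists v.
Qed.

Lemma point_on_line (u v : 'cV[F]_3) :
  (<[M *m emb v]> <= homography M (line_of_coords (emb u)))%VS =
    ((u^T *m v) 0 0 == 0).
Proof.
rewrite -memvE mem_homography // mem_line_of_coords map_trmx -map_mxM mxE.
by rewrite fmorph_eq0.
Qed.

Lemma dim_line (u : 'cV[F]_3) : u != 0 ->
  \dim (homography M (line_of_coords (emb u))) = 2%N.
Proof. by move=> u0; rewrite dim_homography // dim_line_of_coords //
  map_mx_eq0. Qed.

Lemma dim_point (v : 'cV[F]_3) : v != 0 -> \dim <[M *m emb v]>%VS = 1%N.
Proof.
move=> v0; rewrite dim_vline; suff -> : M *m emb v != 0 by [].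
apply: contraNneq v0 => /(congr1 (mulmx (invmx M))); rewrite mulKmx // mulmx0.
by move/eqP; rewrite map_mx_eq0.
Qed.

Lemma lines_ofP l : lines_of pi l <->
  exists2 u : 'cV[F]_3, u != 0 & l = homography M (line_of_coords (emb u)).
Proof.
split=> [[P [Q [/subplaneP[p p0 ->] /subplaneP[r r0 ->] nPQ ->]]]|[u u0 ->]].
  have [u u0 [up ur]] := common_annihilator p r; exists u => //.
  apply/eqP; rewrite eqEdim dim_line // dim_sum_points ?dim_point // andbT.
  by rewrite subv_add !point_on_line up ur eqxx.
have [p [r [up ur _ free_pr]]] := dim2_basis (dim_line_of_coords u0).
have p0 : p != 0.
  apply/eqP => p0; have [] := free_pr 1 0; first
    by rewrite p0 scaler0 scale0r addr0.
  by move/eqP; rewrite oner_eq0.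
have r0 : r != 0.
  apply/eqP => r0; have [] := free_pr 0 1; first
    by rewrite r0 scaler0 scale0r addr0.
  by move=> _ /eqP; rewrite oner_eq0.
have nPQ : <[M *m emb p]>%VS != <[M *m emb r]>%VS.
  apply/eqP => ePQ; have : M *m emb p \in <[M *m emb r]>%VS
    by rewrite -ePQ memv_line.
  rewrite -homography_vline mem_homography // => /emb_vline/vlineP[a pa].
  have [] := free_pr 1 (- a); first by rewrite pa scale1r scaleNr subrr.
  by move/eqP; rewrite oner_eq0.
exists <[M *m emb p]>%VS, <[M *m emb r]>%VS; split=> //.
- by apply/subplaneP; exists p.
- by apply/subplaneP; exists r.
apply/esym/eqP; rewrite eqEdim dim_line // dim_sum_points ?dim_point // andbT.
by rewrite subv_add !point_on_line -!mem_line_of_coords up ur.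
Qed.

(** The matrix N = M^-1 M' maps PG(2, q) into itself. Its columns are multiples
    over L of vectors over F, and so is the sum of its columns; comparing
    coefficients in the basis of these vectors, the multipliers are F-multiples
    of one scalar, so N is a scalar times a matrix over F. *)
Lemma same_subplane (M' : 'M[L]_3) : M' \in unitmx ->
  pi = homography M' @` (@base_subplane F L) ->
  exists2 H : 'M[F]_3, H \in unitmx
  & forall u, homography M' (line_of_coords (emb H *m u)) =
              homography M (line_of_coords u).
Proof.
move=> M'u epi.
have img (v : 'cV[F]_3) : v != 0 -> exists cw : L * 'cV[F]_3,
    M' *m emb v = cw.1 *: (M *m emb cw.2).
  move=> v0; have : pi <[M' *m emb v]>%VS.
    rewrite epi; exists <[emb v]>%VS; first by exists v.
    by rewrite homography_vline.
  case/subplaneP => w w0 e; have := memv_line (M' *m emb v).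
  by rewrite e => /vlineP[c]; exists (c, w).
pose N := invmx M *m M'.
have Nu : N \in unitmx by rewrite unitmx_mul unitmx_inv M_unit.
have imgN (v : 'cV[F]_3) : v != 0 ->
  exists cw : L * 'cV[F]_3, N *m emb v = cw.1 *: emb cw.2.
  case/img => cw e; exists cw.
  by rewrite -mulmxA e -scalemxAr mulKmx.
have img_col (j : 'I_3) : exists cw : L * 'cV[F]_3,
    N *m emb (delta_mx j 0) = cw.1 *: emb cw.2.
  by apply: imgN; apply/cV0Pn; exists j; rewrite mxE !eqxx oner_eq0.
have [g gP] := choice img_col.
have [[c w] cw] : exists cw : L * 'cV[F]_3,
  N *m emb (const_mx 1) = cw.1 *: emb cw.2.
  by apply: imgN; apply/cV0Pn; exists 0; rewrite mxE oner_eq0.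
pose G := \matrix_(i, j) (g j).2 i 0.
pose d : 'cV[L]_3 := \col_j (g j).1.
have NE : N = emb G *m diag_mx d^T.
  apply/matrixP => i j; rewrite mul_mx_diag.
  have /colP/(_ i) := gP j; rewrite map_delta_mx -colE !mxE => ->.
  by rewrite mulrC.
have Gu : G \in unitmx.
  by move: Nu; rewrite NE unitmx_mul map_unitmx => /andP[].
have dE : d = c *: emb (invmx G *m w).
  rewrite map_mxM map_invmx scalemxAr -[c *: _]cw NE -mulmxA mulKmx ?map_unitmx
    //.
  apply/colP => i; rewrite mul_diag_mx !mxE rmorph1 mulr1 //.
pose G' := G *m diag_mx (invmx G *m w)^T.
have NG : N = c *: emb G'.
  have diagZ (X : 'cV[L]_3) : diag_mx (c *: X)^T = c *: diag_mx X^T.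
    by apply/matrixP => i j; rewrite !mxE mulrnAr.
  by rewrite /G' (map_mxM _ G) map_diag_mx -map_trmx NE dE diagZ scalemxAr.
have c0 : c != 0.
  apply: contraTneq Nu => c0; rewrite NG c0 scale0r unitmxE det0 //.
  by rewrite unitr0.
have G'u : G' \in unitmx by move: Nu; rewrite NG unitmxZ ?unitfE // map_unitmx.
have M'E : M' = c *: (M *m emb G') by rewrite scalemxAr -NG mulKVmx.
exists G'^T; first by rewrite unitmx_tr.
move=> u; rewrite M'E homography_scale // homographyM homography_line_of_coords
  ?map_unitmx //.
by rewrite -map_trmx mulmxA -trmx_mul mulmxV ?map_unitmx // trmx1 mul1mx.
Qed.

End Subplanes.

(** * The two kinds of sublines *)

Section Sublines.
Variables (F : finFieldType) (L : fieldExtType F) (tau : L).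
Notation q := #|F|.
Notation emb := (map_mx (in_alg L)).
Hypothesis dimL : \dim {:L} = 3%N.
Hypothesis tau_prim : (q ^ 3).-1.-primitive_root tau.

Definition ref_mx : 'M[L]_3 := mx_of_rows 3 3
  [:: [:: - tau;           1;                  0];
      [:: - tau ^+ q;      1;                  0];
      [:: tau * tau ^+ q;  - tau - tau ^+ q;   1]].

Lemma ref_mxE (v : 'cV[L]_3) : ref_mx *m v = \col_(i < 3)
  [:: v 1 0 - tau * v 0 0; v 1 0 - tau ^+ q * v 0 0;
      tau * tau ^+ q * v 0 0 - (tau + tau ^+ q) * v 1 0 + v ord_max 0]`_i.
Proof.
by apply/colP; apply: ord3P; rewrite !mxE big_ord3 !mxE /=; ring.
Qed.

Lemma tau_frob_neq : tau ^+ q - tau != 0.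
Proof.
have q1 := finNzRing_gt1 F.
rewrite subr_eq0 -[X in _ == X]expr1 (eq_prim_root_expr tau_prim).
have lt0 := ltn_exp_pred_cube q1 (isT : (0 <= 2)%N).
have lt1 := ltn_exp_pred_cube q1 (isT : (1 <= 2)%N).
by rewrite !modn_small ?gtn_eqF // -[X in (X < _)%N]expn1.
Qed.

Lemma ref_mx_unit : ref_mx \in unitmx.
Proof.
rewrite -unitmx_tr -row_free_unit; apply: inj_row_free => v /(congr1 trmx).
rewrite trmx_mul trmxK trmx0; set w := v^T => w0.
have : ref_mx *m w = 0 := w0; rewrite ref_mxE => /colP e.
have e0 : w 1 0 - tau * w 0 0 = 0 by have := e 0; rewrite !mxE.
have e1 : w 1 0 - tau ^+ q * w 0 0 = 0 by have := e 1; rewrite !mxE.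
have e2 : tau * tau ^+ q * w 0 0 - (tau + tau ^+ q) * w 1 0 + w ord_max 0 = 0.
  by have := e ord_max; rewrite !mxE.
have w00 : w 0 0 = 0.
  apply: (mulfI tau_frob_neq); rewrite mulr0.
  have -> : (tau ^+ q - tau) * w 0 0 =
            (w 1 0 - tau * w 0 0) - (w 1 0 - tau ^+ q * w 0 0) by ring.
  by rewrite e0 e1 subrr.
have w10 : w 1 0 = 0 by move: e0; rewrite w00 mulr0 subr0.
have w20 : w ord_max 0 = 0 by move: e2; rewrite w00 w10 !mulr0 subr0 add0r.
apply: trmx_inj; rewrite -/w trmx0; apply/colP; apply: ord3P;
  by rewrite [RHS]mxE.
Qed.

Variable Phi : 'M[L]_3.
Hypothesis Phi_unit : Phi \in unitmx.
Hypothesis Phi_last : forall v : 'cV[L]_3, (Phi *m v) ord_max 0 = v ord_max 0.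

Let M := Phi *m ref_mx.

Lemma M_unit : M \in unitmx.
Proof. by rewrite unitmx_mul Phi_unit ref_mx_unit. Qed.

(** With w = (1, tau, tau^2) and w' its Frobenius conjugate, the reference
    matrix maps w' to a multiple of (1, 0, 0) and w to a multiple of (0, 1, 0):
    a point (x, y, 0) comes from a multiple of x w' - y w, on which u takes the
    value x t^q - y t. *)
Lemma ref_mx_dot (u : 'cV[F]_3) (v : 'cV[L]_3) (t := elt tau u) :
  (tau ^+ q - tau) * ((emb u)^T *m v) 0 0 =
  (ref_mx *m v) 0 0 * t ^+ q - (ref_mx *m v) 1 0 * t
  + (ref_mx *m v) ord_max 0 * ((tau ^+ q - tau) * emb u ord_max 0).
Proof.
have tE : t = emb u 0 0 + emb u 1 0 * tau + emb u ord_max 0 * tau ^+ 2.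
  by rewrite /t /elt big_ord3 !mxE -!scalerAl !mul1r expr0 expr1.
have tqE : t ^+ q = emb u 0 0 + emb u 1 0 * tau ^+ q
  + emb u ord_max 0 * (tau ^+ q) ^+ 2.
  rewrite -[LHS]/(t ^+ (q ^ 1)) -[LHS]/(frob 1 t) tE !rmorphD !rmorphM /=.
  by rewrite !mxE !frob_alg.
by rewrite dot_cV tqE tE ref_mxE !mxE /=; ring.
Qed.

Lemma meet_infinity_line (u : 'cV[F]_3) (t := elt tau u) : u != 0 ->
  meet_infinity (homography M (line_of_coords (emb u))) =
    <[Phi *m infvec t (frob 1 t)]>%VS.
Proof.
move=> u0; have t0 : t != 0 by apply: contraNneq u0 => /(elt_eq0 tau_prim)->.
have ft : frob 1 t = t ^+ q by [].
apply/vspaceP => w; rewrite memv_cap mem_infinity; apply/andP/vlineP.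
  case=> /homographyP[v]; rewrite mem_line_of_coords => /eqP uv ->.
  rewrite -mulmxA Phi_last => /eqP w2.
  have := ref_mx_dot u v; rewrite /= uv w2 -/t mulr0 mul0r addr0 => /esym/eqP.
  rewrite subr_eq0 => /eqP xy.
  exists ((ref_mx *m v) 0 0 / t); rewrite scalemxAr infvecZ; congr (_ *m _).
  rewrite {1}(infvec_eta w2); congr infvec; first by rewrite divfK.
  by rewrite ft mulrAC xy mulfK.
case=> c ->; have last0 : (Phi *m infvec t (frob 1 t)) ord_max 0 = 0
  by rewrite Phi_last infvec2.
rewrite mxE last0 mulr0 eqxx; split=> //; rewrite rpredZ //.
rewrite -[infvec _ _](mulKVmx ref_mx_unit) (mulmxA Phi ref_mx) mem_homography
  ?M_unit //.
rewrite mem_line_of_coords; apply/eqP/(mulfI tau_frob_neq).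
rewrite ref_mx_dot mulKVmx ?ref_mx_unit // infvec0 infvec1 infvec2 -/t ft; ring.
Qed.

Notation pi := (homography M @` (@base_subplane F L)).

Lemma trace3_frob (x : L) : trace3 (frob 1 x) = trace3 x.
Proof. by rewrite /trace3 !frob_frob (frob3 dimL); ring. Qed.

(** The lines u of pi through a point p satisfy u . p = Tr (g t) = 0, and t^q is
    taken as parameter, so that (t, t^q) = (s^(q^2), s). *)
Lemma pencil_subline_trace b : pencil_subline pi b ->
  exists2 gamma, gamma != 0 & b = trace_subline Phi 2 gamma.
Proof.
case=> A /(subplaneP _ _) [p p0 ->] ->.
have [g g0 gE] := moore_functional dimL tau_prim p0.
have on_line u : (u^T *m p) 0 0 = 0 <-> trace3 (g * elt tau u) = 0.
  rewrite -gE; split=> [-> | /eqP]; first by rewrite rmorph0.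
  by rewrite fmorph_eq0 => /eqP.
exists (frob 1 g); first by rewrite fmorph_eq0.
apply/seteqP; split=> X.
  case=> l [/(lines_ofP M_unit)[u u0 ->]].
  rewrite (point_on_line M_unit) => /eqP/on_line tr0 <-.
  exists (frob 1 (elt tau u)); last first.
    by rewrite frob_frob (frob3 dimL) meet_infinity_line.
  split; last by rewrite -rmorphM trace3_frob.
  by rewrite fmorph_eq0; apply: contraNneq u0 => /(elt_eq0 tau_prim)->.
case=> s [s0 tr0] <-; set t := frob 2 s.
have st : s = frob 1 t by rewrite frob_frob (frob3 dimL).
have u0 : coords tau t != 0.
  apply: contraNneq s0 => /(coords_eq0 dimL tau_prim) t0.
  by rewrite st t0 rmorph0.
have et : elt tau (coords tau t) = t by rewrite (coordsK dimL tau_prim).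
exists (homography M (line_of_coords (emb (coords tau t)))).
  split; first by apply/(lines_ofP M_unit); exists (coords tau t).
  rewrite (point_on_line M_unit); apply/eqP/on_line; rewrite et.
  by rewrite -trace3_frob rmorphM /= -st.
by rewrite meet_infinity_line // et -st.
Qed.

(** The line at infinity is spanned by the images of the first two rows of the
    Moore matrix, so these are orthogonal to its line coordinates u. *)
Lemma infinity_coords (u : 'cV[L]_3) : u != 0 ->
  homography M (line_of_coords u) = line_at_infinity L ->
  exists2 c, c != 0 & moore tau *m u = c *: delta_mx ord_max 0.
Proof.
move=> u0 einf.
have dot_pt x y v : ref_mx *m v = infvec x y -> (u^T *m v) 0 0 = 0.
  move=> e; apply/eqP; rewrite -mem_line_of_coords -(mem_homography _ _ M_unit)
    einf.
  by rewrite mem_infinity -mulmxA Phi_last e infvec2.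
have rowE i : (moore tau *m u) i 0 = (u^T *m (row i (moore tau))^T) 0 0.
  by rewrite -trmx_mul -row_mul !mxE.
(* The first row of the Moore matrix represents (0, 1, 0), the second one (1, 0,
   0). *)
have W0 : (moore tau *m u) 0 0 = 0.
  rewrite rowE; apply: (dot_pt 0 (tau - tau ^+ q)); rewrite ref_mxE.
  by apply/colP; apply: ord3P; rewrite !mxE /= !frob0; ring.
have W1 : (moore tau *m u) 1 0 = 0.
  rewrite rowE; apply: (dot_pt (tau ^+ q - tau) 0); rewrite ref_mxE.
  by apply/colP; apply: ord3P; rewrite !mxE /= !rmorphXn /=;
    rewrite -![frob 1 tau]/(tau ^+ q); ring.
exists ((moore tau *m u) ord_max 0).
  apply: contraNneq u0 => W2; rewrite -(mulKmx (moore_unit tau_prim) u).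
  rewrite (_ : moore tau *m u = 0) ?mulmx0 //.
  by apply/colP; apply: ord3P; rewrite [RHS]mxE.
apply/colP; apply: ord3P; rewrite ?W0 ?W1 !mxE /= ?mulr0 //.
by rewrite mulr1.
Qed.

(** In the frame of the reference subplane and in Frobenius coordinates, the
    line at infinity is the last coordinate point; as it is on the dual conic,
    which is defined over F, all three coordinate points are, so the form is Tr
    (al t^(q+1)) = N (t) Tr (al^q / t), with al <> 0 by non-degeneracy. The
    parameter is s = 1 / t, and (t, t^q) is a multiple of (s^q, s). *)
Lemma dual_conic_subline_trace b : dual_conic_subline pi b ->
  exists2 gamma, gamma != 0 & b = trace_subline Phi 1 gamma.
Proof.
case=> D [M' [A [[M'u epi] ndA -> [u [u0 Qu] einf] _]]] ->.
have [H Hu HE] := same_subplane M_unit M'u epi.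
(* A' is the form of the dual conic with respect to M. *)
pose A' := H^T *m A *m H.
have embA' : emb A' = (emb H)^T *m emb A *m emb H by rewrite map_trmx -!map_mxM.
have QA' (v : 'cV[F]_3) : quadform A' v = quadform A (H *m v).
  exact: quadform_congr.
pose Wi := invmx (moore tau).
(* The Gram matrix of A' in Frobenius coordinates. *)
pose D' := Wi^T *m emb A' *m Wi.
have eD : emb A' = (moore tau)^T *m D' *m moore tau.
  rewrite /D' !mulmxA -trmx_mul mulVmx ?moore_unit // trmx1 mul1mx.
  by rewrite -mulmxA mulVmx ?moore_unit // mulmx1.
have cyc : forall i j, frob 1 (D' i j) = D' (i + 1) (j + 1).
  by apply/(moore_formP dimL tau_prim); exists A'.
have D22 : D' ord_max ord_max = 0.
  have eHu : homography M (line_of_coords (invmx (emb H) *m u)) =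
    line_at_infinity L.
    by rewrite -HE mulKVmx ?map_unitmx // einf.
  have v0 : invmx (emb H) *m u != 0.
    apply: contraNneq u0 => /(congr1 (mulmx (emb H))).
    by rewrite mulKVmx ?map_unitmx // mulmx0 => ->.
  have [c c0 Wc] := infinity_coords v0 eHu.
  have : quadform (emb A') (invmx (emb H) *m u) = 0.
    by rewrite embA' quadform_congr mulKVmx ?map_unitmx.
  rewrite eD quadform_congr Wc quadformZ quadformE !mxE /= => /eqP.
  rewrite mulf_eq0 expf_eq0 (negPf c0) /= => /eqP e; rewrite -[RHS]e; ring.
have D00 : D' 0 0 = 0.
  by rewrite (_ : 0 = ord_max + 1 :> 'I_3) -?cyc ?D22 ?rmorph0 //;
    apply: val_inj.
have D11 : D' 1 1 = 0.
  by rewrite (_ : 1 = 0 + 1 :> 'I_3) -?cyc ?D00 ?rmorph0 //; apply: val_inj.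
pose al := D' 0 1 + D' 1 0.
have al1 : D' 1 ord_max + D' ord_max 1 = frob 1 al.
  by rewrite rmorphD /= !cyc; congr (_ + _); congr (D' _ _); apply: val_inj.
have al2 : D' ord_max 0 + D' 0 ord_max = frob 2 al.
  rewrite -[frob 2 al]/(frob (1 + 1) al) -frob_frob -al1 rmorphD /= !cyc.
  by congr (_ + _); congr (D' _ _); apply: val_inj.
have QE (v : 'cV[F]_3) (t := elt tau v) : in_alg L (quadform A' v) =
    al * (t * frob 1 t) + frob 1 al * (frob 1 t * frob 2 t)
      + frob 2 al * (frob 2 t * t).
  rewrite -quadform_emb eD quadform_congr moore_emb // quadformE.
  rewrite frobvec0 frobvec1 frobvec2 D00 D11 D22 -/al al1 al2 -/t; ring.
have al0 : al != 0.
  apply/eqP => al0; have Q0 v : quadform A v = 0.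
    apply: (fmorph_inj (in_alg L)); rewrite -(mulKVmx Hu v) -QA' rmorph0.
    by apply: etrans (QE _) _; rewrite al0 !rmorph0 !mul0r !addr0.
  apply: (ndA (const_mx 1)); rewrite ?Q0 //; last by move=> w;
    rewrite !Q0 addr0.
  by apply/cV0Pn; exists 0; rewrite mxE oner_eq0.
have zeros v : v != 0 -> quadform A' v = 0 <->
  trace3 (frob 1 al * (elt tau v)^-1) = 0.
  move=> v0; set t := elt tau v.
  have t0 : t != 0 by apply: contraNneq v0 => /(elt_eq0 tau_prim)->.
  have ft i : frob i t != 0 by rewrite fmorph_eq0.
  have e : in_alg L (quadform A' v) =
    t * frob 1 t * frob 2 t * trace3 (frob 1 al / t).
    rewrite QE -/t /trace3 !fmorph_div /= !frob_frob (frob3 dimL).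
    rewrite -[(1 + 1)%N]/2%N.
    by field; rewrite t0 !ft.
  split=> [Q0|T0].
    move/eqP: e; rewrite Q0 rmorph0 eq_sym !mulf_eq0 (negPf t0) !(negPf (ft _))
      /=.
    by move/eqP.
  by apply: (fmorph_inj (in_alg L)); rewrite rmorph0; apply: etrans e _;
    rewrite T0 mulr0.
exists (frob 1 al); first by rewrite fmorph_eq0.
have line_pt (t : L) : t != 0 -> <[Phi *m infvec t (frob 1 t)]>%VS =
    <[Phi *m infvec (frob 1 t^-1) t^-1]>%VS.
  move=> t0; have ft : frob 1 t != 0 by rewrite fmorph_eq0.
  rewrite -(vline_scale (Phi *m infvec (frob 1 t^-1) t^-1) (mulf_neq0 t0 ft))
    scalemxAr infvecZ.
  congr (<[_ *m infvec _ _]>%VS); rewrite ?fmorphV /=; field;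
    by rewrite ?t0 ?ft.
apply/seteqP; split=> X.
  case=> l [w [w0 Qw] <-] <-; pose v := invmx H *m w.
  have wE : w = H *m v by rewrite mulKVmx.
  have v0 : v != 0 by apply: contraNneq w0 => v0; rewrite wE v0 mulmx0.
  have t0 : elt tau v != 0 by apply: contraNneq v0 => /(elt_eq0 tau_prim)->.
  exists (elt tau v)^-1.
    by split; rewrite ?invr_eq0 //; apply/zeros; rewrite // QA' -wE.
  by rewrite wE map_mxM HE meet_infinity_line // line_pt.
case=> s [s0 tr0] <-; pose v := coords tau s^-1.
have vE : elt tau v = s^-1 by rewrite (coordsK dimL tau_prim).
have v0 : v != 0.
  apply: contraNneq s0 => /(coords_eq0 dimL tau_prim)/eqP.
  by rewrite invr_eq0.
have Q0 : quadform A' v = 0 by apply/zeros; rewrite // vE invrK.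
exists (homography M' (line_of_coords (emb (H *m v)))).
  exists (H *m v) => //; split; last by rewrite -QA'.
  apply: contraNneq v0 => /(congr1 (mulmx (invmx H))).
  by rewrite mulKmx // mulmx0 => ->.
by rewrite map_mxM HE meet_infinity_line // vE line_pt ?invr_eq0 // invrK.
Qed.

End Sublines.

Lemma cover_homographyP (F : finFieldType) (L : fieldExtType F) (tau : L) r pi
    (C : set {vspace 'cV[F]_7}) : cover_of tau r pi C ->
  exists Phi : 'M[L]_3,
  [/\ Phi \in unitmx, forall v : 'cV_3, (Phi *m v) ord_max 0 = v ord_max 0,
      pi = homography (Phi *m ref_mx tau) @` (@base_subplane F L)
    & C = cover_plane tau Phi r @` [set k | k ^+ (#|F| ^ 2 + #|F| + 1) = 1]].
Proof.
case=> a [b [c [d [e [f [Phi_unit -> ->]]]]]].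
exists (mx_of_rows 3 3 [:: [:: a; b; e]; [:: c; d; f]; [:: 0; 0; 1]]);
  split=> //.
  by move=> v; rewrite mxE big_ord3 !mxE /=; ring.
rewrite /reference_subplane image_comp; congr (_ @` _).
by apply/funext => U /=; rewrite homographyM.
Qed.

Theorem theorem7p3 (F : finFieldType) (L : fieldExtType F) (tau : L)
    (pi : set {vspace 'cV[L]_3}) (C T : set {vspace 'cV[F]_7}) :
  \dim {:L} = 3%N ->
  (#|F| ^ 3).-1.-primitive_root tau ->
  subplane pi ->
  exterior pi ->
  conic_cover tau pi C ->
  tangent_cover tau pi T ->
  (forall b : set {vspace 'cV[L]_3}, pencil_subline pi b ->
     forall P : {vspace 'cV[F]_7}, C P ->
       special_conic L C P (points_covered (regulus tau b) P)) /\
  (forall b : set {vspace 'cV[L]_3}, dual_conic_subline pi b ->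
     forall P : {vspace 'cV[F]_7}, T P ->
       special_conic L T P (points_covered (regulus tau b) P)).
Proof.
move=> dimL tau_prim _ _ /cover_homographyP[Phi [Phi_u Phi_last piE CE]].
rewrite /tangent_cover -{1}(expn1 #|F|).
case/cover_homographyP=> [Phi' [Phi'_u Phi'_last piE' TE]].
split=> b.
  rewrite piE.
  case/(pencil_subline_trace dimL tau_prim Phi_u Phi_last) => g g0 ->.
  by rewrite CE => _ [k k1 <-]; apply: regulus_meets_cover_plane.
rewrite piE'.
case/(dual_conic_subline_trace dimL tau_prim Phi'_u Phi'_last) => g g0 ->.
by rewrite TE => _ [k k1 <-]; apply: regulus_meets_cover_plane.
Qed.
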